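(* Let $p,q\ge0$, $p+q\ge1$. The Schur algebra $\mathcal C_{p,q}$ of the irreducible $C\ell_{p,q}$-module $S_{p,q}$ depends, up to isomorphism, only on $s=p-q$ modulo 8; $\mathcal C_{p,q}\cong\mathcal C(s)$, where $$\mathcal C(1)=\mathbb R(2),\quad \mathcal C(2)=\mathbb C(2),\quad \mathcal C(3)=\mathbb H,\quad \mathcal C(4)=\mathbb H\oplus\mathbb H,$$ $$\mathcal C(5)=\mathbb H,\quad \mathcal C(6)=\mathbb C,\quad \mathcal C(7)=\mathbb R,\quad \mathcal C(8)=\mathbb R\oplus\mathbb R .$$ In particular, it admits the mirror symmetry $(p,q)\mapsto(-q,-p)$ (with $p,q$ read modulo 8), i.e. $\mathcal C_{p,q}\cong\mathcal C_{8k-q,8k-p}$ whenever $8k\ge p,q$.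
   Context: $C\ell_{p,q}$ is the real Clifford algebra of $\mathbb R^{p,q}$ ($p$ positive, $q$ negative squares) with the convention $v^2=-\langle v,v\rangle$ (so $C\ell_{1,0}\cong\mathbb C$), and $C\ell^0_{p,q}$ is its even part. $S_{p,q}$ is an irreducible real $C\ell_{p,q}$-module. The Schur algebra $\mathcal C_{p,q}$ is the real algebra of all endomorphisms of $S_{p,q}$ that are $\mathfrak{so}(p,q)$-invariant, i.e. commute with $C\ell^0_{p,q}$. $\mathbb K(l)$ denotes the algebra of $l\times l$ matrices over $\mathbb K=\mathbb R,\mathbb C,\mathbb H$.
   Formalization: In the mirror symmetry the pair (8k-q, 8k-p) is also required to differ from (0,0), which excludes only p = q = 8k; there the claim fails, since the Schur algebra for (8k,8k) is R⊕R while for (0,0) it is R. *)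

(* Defs.v *)
From HB Require Import structures.
From mathcomp Require Import all_boot all_order all_algebra.
From mathcomp Require Import boolp functions reals complex ring.

Set Implicit Arguments.
Unset Strict Implicit.
Unset Printing Implicit Defensive.

Import Order.TTheory GRing.Theory Num.Theory.
Local Open Scope ring_scope.

(* The Clifford algebra of R^{p,q} with v^2 = - <v,v> on the basis e_A,
   A ranging over the sets of indices; e_A is the product of the e_i, i in A,
   in increasing order.  [clifford_sqr] and [clifford_universal] below identify
   it with the Clifford algebra of the quadratic space. *)

Section CliffordDef.
Variables (R : realType) (p q : nat).
Local Notation I := 'I_(p + q).

Definition bilin_form (u v : 'rV[R]_(p + q)) : R :=
  \sum_(i : I) (if (i < p)%N then u 0 i * v 0 i else - (u 0 i * v 0 i)).

Definition symdiff (A B : {set I}) : {set I} :=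
  [set i | (i \in A) (+) (i \in B)].

(* e_i * e_j = gen_sign i j *: e_{symdiff {i} {j}} *)
Definition gen_sign (i j : I) : R :=
  if (i < j)%N then 1
  else if i == j then (if (i < p)%N then - 1 else 1) else - 1.

(* e_A * e_B = basis_sign A B *: e_{symdiff A B} *)
Definition basis_sign (A B : {set I}) : R :=
  \prod_(i in A) \prod_(j in B) gen_sign i j.

Definition clifford : Type := {ffun {set I} -> R^o}.

HB.instance Definition _ := GRing.Lmodule.on clifford.

Definition clifford_coef (x : clifford) (A : {set I}) : R :=
  (x : {ffun _ -> _}) A.

Definition clifford_basis (A : {set I}) : clifford :=
  [ffun B => (B == A)%:R : R^o].

Definition clifford_mul (x y : clifford) : clifford :=
  [ffun C => \sum_(A : {set I})
     basis_sign A (symdiff A C) *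
     (clifford_coef x A * clifford_coef y (symdiff A C)) : R^o].

Definition clifford_one : clifford := clifford_basis set0.

Lemma symdiffA A B C : symdiff A (symdiff B C) = symdiff (symdiff A B) C.
Proof. by apply/setP=> i; rewrite !inE addbA. Qed.

Lemma symdiffC A B : symdiff A B = symdiff B A.
Proof. by apply/setP=> i; rewrite !inE addbC. Qed.

Lemma symdiff0 A : symdiff A set0 = A.
Proof. by apply/setP=> i; rewrite !inE addbF. Qed.

Lemma symdiffv A : symdiff A A = set0.
Proof. by apply/setP=> i; rewrite !inE addbb. Qed.

Lemma symdiffK A : involutive (symdiff A).
Proof. by move=> B; rewrite symdiffA symdiffv symdiffC symdiff0. Qed.

Lemma gen_sign_sqr i j : gen_sign i j * gen_sign i j = 1.
Proof.
rewrite /gen_sign; case: ifP => _; first by rewrite mul1r.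
by do 2?case: ifP => _; rewrite ?mulrNN mulr1.
Qed.

Lemma prod_symdiff (F : I -> R) A B : (forall i, F i * F i = 1) ->
  \prod_(i in symdiff A B) F i = (\prod_(i in A) F i) * \prod_(i in B) F i.
Proof.
move=> F2; rewrite big_mkcond [X in X * _]big_mkcond [X in _ * X]big_mkcond.
rewrite -big_split; apply: eq_bigr => i _ /=; rewrite inE.
by case: (i \in A) (i \in B) => [] [] /=; rewrite ?F2 ?mulr1 ?mul1r.
Qed.

Lemma basis_sign_symdiffr A B C :
  basis_sign A (symdiff B C) = basis_sign A B * basis_sign A C.
Proof.
rewrite /basis_sign -big_split; apply: eq_bigr => i _ /=.
by apply: prod_symdiff => j; exact: gen_sign_sqr.
Qed.

Lemma basis_sign_symdiffl A B C :
  basis_sign (symdiff A B) C = basis_sign A C * basis_sign B C.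
Proof.
apply: prod_symdiff => i; rewrite -big_split big1 // => j _.
exact: gen_sign_sqr.
Qed.

Lemma basis_sign0r A : basis_sign A set0 = 1.
Proof. by rewrite /basis_sign big1 // => i _; rewrite big_set0. Qed.

Lemma basis_sign0l A : basis_sign set0 A = 1.
Proof. by rewrite /basis_sign big_set0. Qed.

Lemma clifford_coefM x y C : clifford_coef (clifford_mul x y) C =
  \sum_(A : {set I}) basis_sign A (symdiff A C) *
     (clifford_coef x A * clifford_coef y (symdiff A C)).
Proof. by rewrite /clifford_coef ffunE. Qed.

Lemma cliffordP (x y : clifford) :
  (forall A, clifford_coef x A = clifford_coef y A) -> x = y.
Proof. by move=> h; apply/ffunP. Qed.

Lemma clifford_coefD x y A :
  clifford_coef (x + y) A = clifford_coef x A + clifford_coef y A.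
Proof. by rewrite /clifford_coef ffunE. Qed.

Lemma clifford_coefZ a x A : clifford_coef (a *: x) A = a * clifford_coef x A.
Proof. by rewrite /clifford_coef ffunE. Qed.

Lemma clifford_coef_basis A B :
  clifford_coef (clifford_basis A) B = (B == A)%:R.
Proof. by rewrite /clifford_coef ffunE. Qed.

Lemma clifford_mulA : associative clifford_mul.
Proof.
move=> x y z; apply: cliffordP => D; rewrite !clifford_coefM.
under [RHS]eq_bigr => C _ do rewrite clifford_coefM mulr_suml mulr_sumr.
rewrite exchange_big /=; apply: eq_bigr => A _.
rewrite clifford_coefM mulr_sumr mulr_sumr.
rewrite [RHS](reindex_inj (inv_inj (symdiffK A))) /=; apply: eq_bigr => B _.
rewrite symdiffK.
set E := symdiff (symdiff A B) D.
have -> : symdiff B (symdiff A D) = E by rewrite symdiffA (symdiffC B).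
have -> : symdiff A D = symdiff B E.
  by rewrite /E (symdiffC A B) -symdiffA symdiffK.
by rewrite basis_sign_symdiffr basis_sign_symdiffl; ring.
Qed.

Lemma clifford_mul1l : left_id clifford_one clifford_mul.
Proof.
move=> x; apply: cliffordP => C; rewrite clifford_coefM (bigD1 set0) //=.
rewrite big1 => [|A /negPf A0]; last first.
  by rewrite clifford_coef_basis A0 mul0r mulr0.
by rewrite clifford_coef_basis eqxx symdiffC symdiff0 basis_sign0l !mul1r addr0.
Qed.

Lemma clifford_mul1r : right_id clifford_one clifford_mul.
Proof.
move=> x; apply: cliffordP => C; rewrite clifford_coefM (bigD1 C) //=.
rewrite big1 => [|A AC]; last first.
  rewrite clifford_coef_basis; case: eqP => [AC0|_]; last by rewrite !mulr0.
  by rewrite -(symdiffK A C) AC0 symdiff0 eqxx in AC.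
by rewrite clifford_coef_basis symdiffv eqxx basis_sign0r mul1r mulr1 addr0.
Qed.

Lemma clifford_mulDl : left_distributive clifford_mul +%R.
Proof.
move=> x y z; apply: cliffordP => C; rewrite clifford_coefD !clifford_coefM.
by rewrite -big_split; apply: eq_bigr => A _ /=; rewrite clifford_coefD; ring.
Qed.

Lemma clifford_mulDr : right_distributive clifford_mul +%R.
Proof.
move=> x y z; apply: cliffordP => C; rewrite clifford_coefD !clifford_coefM.
by rewrite -big_split; apply: eq_bigr => A _ /=; rewrite clifford_coefD; ring.
Qed.

Lemma clifford_oner_neq0 : clifford_one != 0.
Proof.
apply/eqP => /(congr1 (clifford_coef^~ set0)).
rewrite clifford_coef_basis eqxx /clifford_coef ffunE => /eqP.
by rewrite oner_eq0.
Qed.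

HB.instance Definition _ := GRing.Zmodule_isNzRing.Build clifford
  clifford_mulA clifford_mul1l clifford_mul1r clifford_mulDl clifford_mulDr
  clifford_oner_neq0.

Lemma clifford_scalerAl (a : R) (x y : clifford) : a *: (x * y) = (a *: x) * y.
Proof.
apply: cliffordP => C; rewrite clifford_coefZ !clifford_coefM mulr_sumr.
by apply: eq_bigr => A _; rewrite clifford_coefZ; ring.
Qed.

HB.instance Definition _ :=
  GRing.Lmodule_isLalgebra.Build R clifford clifford_scalerAl.

Lemma clifford_scalerAr (a : R) (x y : clifford) : a *: (x * y) = x * (a *: y).
Proof.
apply: cliffordP => C; rewrite clifford_coefZ !clifford_coefM mulr_sumr.
by apply: eq_bigr => A _; rewrite clifford_coefZ; ring.
Qed.

HB.instance Definition _ :=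
  GRing.Lalgebra_isAlgebra.Build R clifford clifford_scalerAr.

Definition clifford_vec (v : 'rV[R]_(p + q)) : clifford :=
  \sum_(i : I) v 0 i *: clifford_basis [set i].

Definition clifford_even (x : clifford) : Prop :=
  forall A : {set I}, odd #|A| -> clifford_coef x A = 0.

Lemma clifford_basisM A B : clifford_basis A * clifford_basis B =
  basis_sign A B *: clifford_basis (symdiff A B).
Proof.
apply: cliffordP => C; rewrite clifford_coefM clifford_coefZ (bigD1 A) //=.
rewrite big1 => [|A' /negPf A'A]; last first.
  by rewrite clifford_coef_basis A'A mul0r mulr0.
rewrite !clifford_coef_basis eqxx mul1r addr0.
have [->|/eqP CAB] := eqVneq C (symdiff A B).
  by rewrite symdiffK eqxx.
by case: eqP => [H|_]; rewrite ?mulr0 //; case: CAB; rewrite -H symdiffK.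
Qed.

Lemma clifford_basis0 : clifford_basis set0 = 1.
Proof. by []. Qed.

Lemma clifford_sum_basis (x : clifford) :
  x = \sum_(A : {set I}) clifford_coef x A *: clifford_basis A.
Proof.
apply: cliffordP => B; rewrite {2}/clifford_coef sum_ffunE (bigD1 B) //=.
rewrite big1 => [|A AB]; rewrite !ffunE ?eqxx ?addr0 /GRing.scale /= ?mulr1 //.
by rewrite eq_sym (negPf AB) mulr0.
Qed.

Lemma clifford_vec_is_linear : linear clifford_vec.
Proof.
move=> a u v; rewrite /clifford_vec scaler_sumr -big_split.
by apply: eq_bigr => i _ /=; rewrite !mxE scalerDl scalerA.
Qed.

HB.instance Definition _ :=
  GRing.isLinear.Build R _ _ _ clifford_vec clifford_vec_is_linear.

Lemma clifford_vec_delta i :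
  clifford_vec (delta_mx 0 i) = clifford_basis [set i].
Proof.
rewrite /clifford_vec (bigD1 i) //= big1 => [|j ji]; rewrite !mxE eqxx.
  by rewrite eqxx scale1r addr0.
by rewrite (negPf ji) scale0r.
Qed.

Lemma clifford_sqr v : clifford_vec v * clifford_vec v = (- bilin_form v v)%:A.
Proof.
pose w i j : clifford :=
  (v 0 i * v 0 j) *: (clifford_basis [set i] * clifford_basis [set j]).
have -> : clifford_vec v * clifford_vec v = \sum_i \sum_j w i j.
  rewrite /clifford_vec mulr_suml; apply: eq_bigr => i _.
  rewrite mulr_sumr; apply: eq_bigr => j _.
  by rewrite /w -scalerA -scalerAr -scalerAl scalerA mulrC -scalerA.
have sgn1 i j : basis_sign [set i] [set j] = gen_sign i j.
  by rewrite /basis_sign !big_set1.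
have wC i j : i != j -> w i j = - w j i.
  move=> ij; rewrite /w !clifford_basisM !sgn1 symdiffC -scalerN -scaleNr mulrC.
  congr (_ *: (_ *: _)); rewrite /gen_sign [j == i]eq_sym (negPf ij).
  by case: ltngtP => [_|_|/val_inj /eqP]; rewrite ?opprK // (negPf ij).
have wii i : w i i = (- (if (i < p)%N then v 0 i * v 0 i
                         else - (v 0 i * v 0 i)))%:A.
  rewrite /w clifford_basisM sgn1 symdiffv clifford_basis0 /gen_sign ltnn eqxx.
  by rewrite scalerA; case: ifP; rewrite ?mulrN1 ?mulr1 ?opprK.
have -> : \sum_i \sum_j w i j = \sum_i w i i.
  pose T := \sum_i \sum_(j | j != i) w i j.
  have -> : \sum_i \sum_j w i j = \sum_i w i i + T.
    by rewrite -big_split; apply: eq_bigr => i _; rewrite (bigD1 i).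
  have TN : T = - T.
    rewrite {1}/T; under eq_bigr => i _ do rewrite big_mkcond.
    rewrite exchange_big -sumrN; apply: eq_bigr => i _ /=.
    rewrite -big_mkcond -sumrN /=.
    by apply: eq_big => [j|j]; rewrite eq_sym // => /wC.
  have: 2%:R *: T = 0 by rewrite scaler_nat mulr2n {1}TN addNr.
  by move/eqP; rewrite scaler_eq0 pnatr_eq0 /= => /eqP ->; rewrite addr0.
under eq_bigr => i _ do rewrite wii.
by rewrite /bilin_form -sumrN scaler_suml.
Qed.

Section Universal.
Variables (B : algType R) (f : {linear 'rV[R]_(p + q) -> B}).
Hypothesis f_sqr : forall v, f v * f v = (- bilin_form v v)%:A.

Let g i := f (delta_mx 0 i).
Let P (A : {set I}) := \prod_(i in A) g i.

Lemma bilin_form_delta i j : bilin_form (delta_mx 0 i) (delta_mx 0 j) =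
  (if (i < p)%N then 1 else - 1) *+ (i == j).
Proof.
rewrite /bilin_form (bigD1 i) //= big1 => [|k ki]; rewrite !mxE !eqxx /=.
  by rewrite mul1r addr0; case: (i == j); case: ifP; rewrite ?oppr0.
by rewrite (negPf ki) mul0r oppr0 if_same.
Qed.

Lemma bilin_formD u v : bilin_form (u + v) (u + v) =
  bilin_form u u + bilin_form v v + 2%:R * bilin_form u v.
Proof.
rewrite /bilin_form mulr_sumr -!big_split; apply: eq_bigr => i _ /=.
by rewrite !mxE; case: ifP => _; ring.
Qed.

Lemma gen_sqr i : g i * g i = (gen_sign i i)%:A.
Proof.
by rewrite f_sqr bilin_form_delta eqxx mulr1n /gen_sign ltnn eqxx; case: ifP;
  rewrite ?opprK.
Qed.

Lemma gen_anti i j : i != j -> g i * g j = - (g j * g i).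
Proof.
move=> ij; apply/eqP; rewrite -addr_eq0; apply/eqP.
have := f_sqr (delta_mx 0 i + delta_mx 0 j).
have bij : bilin_form (delta_mx 0 i) (delta_mx 0 j) = 0.
  by rewrite bilin_form_delta (negPf ij).
rewrite bilin_formD bij mulr0 addr0 raddfD opprD scalerDl -!f_sqr.
rewrite mulrDl !mulrDr !addrA => /addIr; rewrite -!addrA -[RHS]addr0.
by move/addrI; exact.
Qed.

Lemma enum_ord_split (i : I) : exists l1 l2,
  [/\ index_enum I = l1 ++ i :: l2,
      forall j, j \in l1 -> (j < i)%N & forall j, j \in l2 -> (i < j)%N].
Proof.
have srt : pairwise (fun a b : I => (a < b)%N) (index_enum I).
  rewrite -[index_enum _]enumT.
  rewrite -(pairwise_map val ltn) val_enum_ord -sorted_pairwise.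
    exact: iota_ltn_sorted.
  by move=> ? ? ?; exact: ltn_trans.
have := mem_index_enum i; case/splitPr E: _ / => [l1 l2].
move: srt; rewrite E pairwise_cat => /and3P[/allrelP h1 _] /=.
case/andP=> /allP h2 _; exists l1, l2; split=> // j jl.
by apply: h1; rewrite ?mem_head.
Qed.

Lemma gen_mul_prod i (A : {set I}) :
  g i * P A = basis_sign [set i] A *: P (symdiff [set i] A).
Proof.
have [l1 [l2 [E h1 h2]]] := enum_ord_split i.
rewrite /P /basis_sign big_set1 E !big_cat !big_cons /=.
have key (l : seq I) : (forall j, j \in l -> (j < i)%N) ->
    g i * \prod_(j <- l | j \in A) g j =
    (\prod_(j <- l | j \in A) gen_sign i j) *:
      (\prod_(j <- l | j \in A) g j * g i).
  elim: l => [|j l IHl] hl; first by rewrite !big_nil mulr1 mul1r scale1r.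
  rewrite !big_cons.
  have {}IHl : _ := IHl (fun k kl => hl k (@mem_behead _ (j :: l) k kl)).
  case: ifP => _ //; have ji := hl j (mem_head _ _).
  have ij : i != j by apply: contraTneq ji => ->; rewrite ltnn.
  have sij : gen_sign i j = - 1.
    by rewrite /gen_sign ltnNge (ltnW ji) /= (negPf ij).
  rewrite mulrA gen_anti // mulNr -[g j * g i * _]mulrA IHl.
  by rewrite sij mulN1r scaleNr -scalerAr mulrA.
have sgn2 : \prod_(j <- l2 | j \in A) gen_sign i j = 1.
  by rewrite big_seq_cond big1 // => j /andP[/h2 ij _]; rewrite /gen_sign ij.
have same (l : seq I) : i \notin l ->
    \prod_(j <- l | j \in symdiff [set i] A) g j = \prod_(j <- l | j \in A) g j.
  move=> il; rewrite big_seq_cond [RHS]big_seq_cond; apply: eq_bigl => j.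
  rewrite !inE; have [jl|//] := boolP (j \in l).
  by case: eqVneq jl il => [-> ->|].
rewrite !same; first last.
- by apply/negP => /h1; rewrite ltnn.
- by apply/negP => /h2; rewrite ltnn.
rewrite mulrA (key _ h1) sgn2 !inE eqxx -scalerAl -[in RHS]scalerA -mulrA.
congr (_ *: _); case: ifP => _ /=; last by rewrite scale1r.
by rewrite [g i * (_ * _)]mulrA gen_sqr -scalerAl mul1r -scalerAr mulr1.
Qed.

Lemma prod_mul_prod (A C : {set I}) :
  P A * P C = basis_sign A C *: P (symdiff A C).
Proof.
elim/ltn_ind: {A}#|A| {-2}A (erefl #|A|) => n IHn A An.
have [->|A0] := set_0Vmem A.
  by rewrite /P big_set0 basis_sign0l mul1r scale1r symdiffC symdiff0.
case: A0 => i iA; pose A' := symdiff [set i] A.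
have A'D : A' = A :\ i.
  apply/setP => j; rewrite !inE; case: (eqVneq j i) => [->|//].
  by rewrite iA.
have AE : A = symdiff [set i] A' by rewrite symdiffK.
have cA' : (#|A'| < n)%N by rewrite -An (cardsD1 i A) iA A'D.
have sgnK : basis_sign [set i] A' * basis_sign [set i] A' = 1.
  rewrite /basis_sign big_set1 -big_split big1 // => j _.
  exact: gen_sign_sqr.
have PA : P A = basis_sign [set i] A' *: (g i * P A').
  by rewrite gen_mul_prod -AE scalerA sgnK scale1r.
rewrite PA -scalerAl -mulrA (IHn _ cA') // -scalerAr gen_mul_prod !scalerA.
rewrite symdiffA -AE basis_sign_symdiffr {2}AE basis_sign_symdiffl.
by congr (_ *: _); rewrite -[RHS]mul1r -sgnK; ring.
Qed.

Definition clifford_lift (x : clifford) : B :=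
  \sum_(A : {set I}) clifford_coef x A *: P A.

Lemma clifford_lift_is_linear : linear clifford_lift.
Proof.
move=> a x y; rewrite /clifford_lift scaler_sumr -big_split.
apply: eq_bigr => A _ /=.
by rewrite clifford_coefD clifford_coefZ scalerDl scalerA.
Qed.

Lemma clifford_lift_is_monoid_morphism : monoid_morphism clifford_lift.
Proof.
split=> [|x y].
  rewrite /clifford_lift (bigD1 set0) //= big1 => [|A /negPf A0].
    by rewrite clifford_coef_basis eqxx scale1r addr0 /P big_set0.
  by rewrite clifford_coef_basis A0 scale0r.
rewrite {1}/clifford_lift.
under eq_bigr => C _ do rewrite clifford_coefM scaler_suml.
rewrite exchange_big [in RHS]/clifford_lift mulr_suml; apply: eq_bigr => A _ /=.
rewrite (reindex_inj (inv_inj (symdiffK A))) mulr_sumr; apply: eq_bigr => C _ /=.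
rewrite symdiffK -scalerAl -scalerAr prod_mul_prod !scalerA; congr (_ *: _).
by ring.
Qed.

HB.instance Definition _ :=
  GRing.isLinear.Build R _ _ _ clifford_lift clifford_lift_is_linear.
HB.instance Definition _ :=
  GRing.isMonoidMorphism.Build clifford B clifford_lift
    clifford_lift_is_monoid_morphism.

Lemma clifford_lift_vec v : clifford_lift (clifford_vec v) = f v.
Proof.
rewrite raddf_sum [in RHS](row_sum_delta v) raddf_sum; apply: eq_bigr => i _ /=.
rewrite !linearZ /=; congr (_ *: _).
rewrite /clifford_lift (bigD1 [set i]) //= big1 => [|A /negPf Ai].
  by rewrite clifford_coef_basis eqxx scale1r addr0 /P big_set1.
by rewrite clifford_coef_basis Ai scale0r.
Qed.

Lemma clifford_hom_unique (F G : {lrmorphism clifford -> B}) :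
  (forall v, F (clifford_vec v) = G (clifford_vec v)) -> F =1 G.
Proof.
move=> FG x; rewrite (clifford_sum_basis x) !raddf_sum; apply: eq_bigr => A _ /=.
rewrite !linearZ_LR; congr (_ *: _).
elim/ltn_ind: {A}#|A| {-2}A (erefl #|A|) => n IHn A An.
have [->|[i iA]] := set_0Vmem A; first by rewrite clifford_basis0 !rmorph1.
pose A' := symdiff [set i] A.
have cA' : (#|A'| < n)%N.
  rewrite -An (cardsD1 i A) iA /A' ltnS; apply: eq_leq; apply: eq_card => j.
  by rewrite !inE; case: (eqVneq j i) => [->|//]; rewrite iA.
have sgnK : basis_sign [set i] A' * basis_sign [set i] A' = 1.
  rewrite /basis_sign big_set1 -big_split big1 // => j _.
  exact: gen_sign_sqr.
have -> : clifford_basis A =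
    basis_sign [set i] A' *: (clifford_vec (delta_mx 0 i) * clifford_basis A').
  by rewrite clifford_vec_delta clifford_basisM symdiffK scalerA sgnK scale1r.
by rewrite !linearZ_LR !rmorphM /= FG (IHn _ cA').
Qed.

Lemma clifford_universal :
  exists2 F : {lrmorphism clifford -> B},
    forall v, F (clifford_vec v) = f v &
    forall G : {lrmorphism clifford -> B},
      (forall v, G (clifford_vec v) = f v) -> G =1 F.
Proof.
pose F : {lrmorphism clifford -> B} := clifford_lift.
exists F => [v|G Gv]; first exact: clifford_lift_vec.
by apply: clifford_hom_unique => v; rewrite Gv; exact/esym/clifford_lift_vec.
Qed.

End Universal.
End CliffordDef.

Definition irreducible_module (A : nzRingType) (S : lmodType A) : Prop :=
  (exists v : S, v != 0) /\
  (forall W : {pred S}, submod_closed W ->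
     (forall v, v \in W -> v = 0) \/ (forall v, v \in W)).

Record irrModule (A : nzRingType) := IrrModule {
  irr_module :> lmodType A;
  irr_moduleP : irreducible_module irr_module }.

Section Schur.
Variables (R : realType) (p q : nat) (S : irrModule (clifford R p q)).

(* S is a real vector space through a |-> a%:A, R -> clifford R p q *)
Definition real_linear (h : S -> S) : Prop :=
  forall (a : R) (u v : S), h (a%:A *: u + v) = a%:A *: h u + h v.

Definition so_invariant (h : S -> S) : Prop :=
  forall x : clifford R p q, clifford_even x -> forall v, h (x *: v) = x *: h v.

Definition schur_pred : {pred S -> S} :=
  fun h => `[< real_linear h /\ so_invariant h >].

Record schur := Schur { schur_fun :> S -> S; _ : schur_fun \in schur_pred }.

HB.instance Definition _ := [isSub for schur_fun].
HB.instance Definition _ := [Choice of schur by <:].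

Lemma schur_eqP (h k : schur) : h =1 k -> h = k.
Proof. by move=> hk; apply: val_inj; apply/funext. Qed.

Lemma schur_linear (h : schur) : real_linear h.
Proof. by case: h => h /= /asboolP[]. Qed.

Lemma schur_invariant (h : schur) : so_invariant h.
Proof. by case: h => h /= /asboolP[]. Qed.

Lemma scalar_even (a : R) : @clifford_even R p q a%:A.
Proof.
move=> A oA; rewrite clifford_coefZ -clifford_basis0 clifford_coef_basis.
by case: eqP oA => [->|_ _]; rewrite ?cards0 ?mulr0.
Qed.

Lemma scalar_comm (a : R) (x : clifford R p q) : a%:A * x = x * a%:A.
Proof. by rewrite -scalerAl -scalerAr mul1r mulr1. Qed.

Lemma schur_predP (h : S -> S) :
  (forall u v, h (u + v) = h u + h v) -> so_invariant h -> h \in schur_pred.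
Proof.
move=> hD hE; apply/asboolP; split=> // a u v.
by rewrite hD hE //; exact: scalar_even.
Qed.

Lemma schurD (h : schur) u v : h (u + v) = h u + h v.
Proof. by have := schur_linear h 1 u v; rewrite !scale1r. Qed.

Lemma schur_add_subproof (h k : schur) : (fun v => h v + k v) \in schur_pred.
Proof.
apply: schur_predP => [u v|x xE v]; first by rewrite !schurD addrACA.
by rewrite !(schur_invariant _ xE) scalerDr.
Qed.
Definition schur_add h k := Schur (schur_add_subproof h k).

Lemma schur_zero_subproof : (fun _ : S => 0) \in schur_pred.
Proof. by apply: schur_predP => [u v|x _ v]; rewrite ?addr0 ?scaler0. Qed.
Definition schur_zero := Schur schur_zero_subproof.

Lemma schur_opp_subproof (h : schur) : (fun v => - h v) \in schur_pred.
Proof.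
apply: schur_predP => [u v|x xE v]; first by rewrite schurD opprD.
by rewrite (schur_invariant _ xE) scalerN.
Qed.
Definition schur_opp h := Schur (schur_opp_subproof h).

Lemma schur_mul_subproof (h k : schur) : h \o k \in schur_pred.
Proof.
apply: schur_predP => [u v|x xE v] /=; first by rewrite !schurD.
by rewrite !(schur_invariant _ xE).
Qed.
Definition schur_mul h k := Schur (schur_mul_subproof h k).

Lemma schur_one_subproof : (id : S -> S) \in schur_pred.
Proof. exact: schur_predP. Qed.
Definition schur_one := Schur schur_one_subproof.

Lemma schur_scale_subproof (a : R) (h : schur) :
  (fun v => a%:A *: h v) \in schur_pred.
Proof.
apply: schur_predP => [u v|x xE v]; first by rewrite schurD scalerDr.
by rewrite (schur_invariant _ xE) !scalerA scalar_comm.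
Qed.
Definition schur_scale a h := Schur (schur_scale_subproof a h).

Lemma schur_addA : associative schur_add.
Proof. by move=> f g h; apply: schur_eqP => v; exact: addrA. Qed.
Lemma schur_addC : commutative schur_add.
Proof. by move=> f g; apply: schur_eqP => v; exact: addrC. Qed.
Lemma schur_add0 : left_id schur_zero schur_add.
Proof. by move=> f; apply: schur_eqP => v; exact: add0r. Qed.
Lemma schur_addN : left_inverse schur_zero schur_opp schur_add.
Proof. by move=> f; apply: schur_eqP => v; exact: addNr. Qed.

HB.instance Definition _ :=
  GRing.isZmodule.Build schur schur_addA schur_addC schur_add0 schur_addN.

Lemma schur_mulA : associative schur_mul.
Proof. by move=> f g h; exact: schur_eqP. Qed.
Lemma schur_mul1l : left_id schur_one schur_mul.
Proof. by move=> f; exact: schur_eqP. Qed.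
Lemma schur_mul1r : right_id schur_one schur_mul.
Proof. by move=> f; exact: schur_eqP. Qed.
Lemma schur_mulDl : left_distributive schur_mul +%R.
Proof. by move=> f g h; exact: schur_eqP. Qed.
Lemma schur_mulDr : right_distributive schur_mul +%R.
Proof. by move=> f g h; apply: schur_eqP => v; exact: schurD. Qed.
Lemma schur_oner_neq0 : schur_one != 0.
Proof.
case: (irr_moduleP S) => -[v v0] _; apply/eqP => h.
by move/eqP: v0; apply; exact: (congr1 (fun k : schur => k v) h).
Qed.

HB.instance Definition _ := GRing.Zmodule_isNzRing.Build schur
  schur_mulA schur_mul1l schur_mul1r schur_mulDl schur_mulDr schur_oner_neq0.

Lemma schur_scaleA a b h : schur_scale a (schur_scale b h) = schur_scale (a * b) h.
Proof.
by apply: schur_eqP => v /=; rewrite scalerA -scalerAl mul1r scalerA.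
Qed.
Lemma schur_scale1 : left_id 1 schur_scale.
Proof. by move=> h; apply: schur_eqP => v /=; rewrite !scale1r. Qed.
Lemma schur_scaleDr : right_distributive schur_scale +%R.
Proof. by move=> a h k; apply: schur_eqP => v; exact: scalerDr. Qed.
Lemma schur_scaleDl h : {morph schur_scale^~ h : a b / a + b}.
Proof. by move=> a b; apply: schur_eqP => v /=; rewrite !scalerDl. Qed.

HB.instance Definition _ := GRing.Zmodule_isLmodule.Build R schur
  schur_scaleA schur_scale1 schur_scaleDr schur_scaleDl.

Lemma schur_scalerAl (a : R) (h k : schur) : a *: (h * k) = (a *: h) * k.
Proof. exact: schur_eqP. Qed.
HB.instance Definition _ :=
  GRing.Lmodule_isLalgebra.Build R schur schur_scalerAl.

Lemma schur_scalerAr (a : R) (h k : schur) : a *: (h * k) = h * (a *: k).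
Proof.
by apply: schur_eqP => v; rewrite /= (schur_invariant h (@scalar_even a)).
Qed.
HB.instance Definition _ :=
  GRing.Lalgebra_isAlgebra.Build R schur schur_scalerAr.

End Schur.

(* [Rcomplex R] is the library's copy of R[i] with its real vector space
   structure. *)
HB.instance Definition _ (R : realType) :=
  GRing.Lalgebra_isComAlgebra.Build R (Rcomplex R).

Section Quaternion.
Variable R : realType.

(* Quat a b c d is a + b i + c j + d k *)
Record quat := Quat { quat_re : R; quat_i : R; quat_j : R; quat_k : R }.

Definition quat_tuple (x : quat) : R * R * R * R :=
  (quat_re x, quat_i x, quat_j x, quat_k x).
Definition tuple_quat (t : R * R * R * R) : quat :=
  let: (a, b, c, d) := t in Quat a b c d.
Lemma quat_tupleK : cancel quat_tuple tuple_quat. Proof. by case. Qed.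

HB.instance Definition _ := Choice.copy quat (can_type quat_tupleK).

Definition quat_zero := Quat 0 0 0 0.
Definition quat_one := Quat 1 0 0 0.
Definition quat_opp (x : quat) :=
  let: Quat a b c d := x in Quat (- a) (- b) (- c) (- d).
Definition quat_add (x y : quat) :=
  let: Quat a b c d := x in let: Quat a' b' c' d' := y in
  Quat (a + a') (b + b') (c + c') (d + d').
Definition quat_mul (x y : quat) :=
  let: Quat a b c d := x in let: Quat a' b' c' d' := y in
  Quat (a * a' - b * b' - c * c' - d * d')
       (a * b' + b * a' + c * d' - d * c')
       (a * c' - b * d' + c * a' + d * b')
       (a * d' + b * c' - c * b' + d * a').
Definition quat_scale (t : R) (x : quat) :=
  let: Quat a b c d := x in Quat (t * a) (t * b) (t * c) (t * d).

Lemma quat_addA : associative quat_add.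
Proof. by case=> ? ? ? ? [? ? ? ?] [? ? ? ?]; congr Quat; ring. Qed.
Lemma quat_addC : commutative quat_add.
Proof. by case=> ? ? ? ? [? ? ? ?]; congr Quat; ring. Qed.
Lemma quat_add0 : left_id quat_zero quat_add.
Proof. by case=> ? ? ? ?; congr Quat; ring. Qed.
Lemma quat_addN : left_inverse quat_zero quat_opp quat_add.
Proof. by case=> ? ? ? ?; congr Quat; ring. Qed.

HB.instance Definition _ :=
  GRing.isZmodule.Build quat quat_addA quat_addC quat_add0 quat_addN.

Lemma quat_mulA : associative quat_mul.
Proof. by case=> ? ? ? ? [? ? ? ?] [? ? ? ?]; congr Quat; ring. Qed.
Lemma quat_mul1l : left_id quat_one quat_mul.
Proof. by case=> ? ? ? ?; congr Quat; ring. Qed.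
Lemma quat_mul1r : right_id quat_one quat_mul.
Proof. by case=> ? ? ? ?; congr Quat; ring. Qed.
Lemma quat_mulDl : left_distributive quat_mul +%R.
Proof. by case=> ? ? ? ? [? ? ? ?] [? ? ? ?]; congr Quat; ring. Qed.
Lemma quat_mulDr : right_distributive quat_mul +%R.
Proof. by case=> ? ? ? ? [? ? ? ?] [? ? ? ?]; congr Quat; ring. Qed.
Lemma quat_oner_neq0 : quat_one != 0.
Proof. by apply/eqP => -[] /eqP; rewrite oner_eq0. Qed.

HB.instance Definition _ := GRing.Zmodule_isNzRing.Build quat
  quat_mulA quat_mul1l quat_mul1r quat_mulDl quat_mulDr quat_oner_neq0.

Lemma quat_scaleA a b x : quat_scale a (quat_scale b x) = quat_scale (a * b) x.
Proof. by case: x => ? ? ? ?; congr Quat; ring. Qed.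
Lemma quat_scale1 : left_id 1 quat_scale.
Proof. by case=> ? ? ? ?; congr Quat; ring. Qed.
Lemma quat_scaleDr : right_distributive quat_scale +%R.
Proof. by move=> t [? ? ? ?] [? ? ? ?]; congr Quat; ring. Qed.
Lemma quat_scaleDl x : {morph quat_scale^~ x : a b / a + b}.
Proof. by case: x => ? ? ? ? a b; congr Quat; ring. Qed.

HB.instance Definition _ := GRing.Zmodule_isLmodule.Build R quat
  quat_scaleA quat_scale1 quat_scaleDr quat_scaleDl.

Lemma quat_scalerAl (a : R) (x y : quat) : a *: (x * y) = (a *: x) * y.
Proof. by case: x y => ? ? ? ? [? ? ? ?]; congr Quat; ring. Qed.
HB.instance Definition _ := GRing.Lmodule_isLalgebra.Build R quat quat_scalerAl.

Lemma quat_scalerAr (a : R) (x y : quat) : a *: (x * y) = x * (a *: y).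
Proof. by case: x y => ? ? ? ? [? ? ? ?]; congr Quat; ring. Qed.
HB.instance Definition _ := GRing.Lalgebra_isAlgebra.Build R quat quat_scalerAr.

End Quaternion.

(* 'M[K]_n is canonically an algebra over K; [matalg K n] is the same ring as
   an algebra over the base ring R of the R-algebra K. *)
Definition matalg (R : comNzRingType) (K : algType R) (n : nat) : Type := 'M[K]_n.

Section MatAlg.
Variables (R : comNzRingType) (K : algType R).

HB.instance Definition _ n := GRing.Zmodule.copy (matalg K n) 'M[K]_n.
HB.instance Definition _ n := GRing.NzRing.copy (matalg K n.+1) 'M[K]_n.+1.

Definition matalg_scale n (a : R) (M : matalg K n) : matalg K n :=
  map_mx (GRing.scale a) (M : 'M[K]_n).

Lemma matalg_scaleA n a b (M : matalg K n) :
  matalg_scale a (matalg_scale b M) = matalg_scale (a * b) M.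
Proof. by apply/matrixP => i j; rewrite !mxE scalerA. Qed.
Lemma matalg_scale1 n : left_id 1 (@matalg_scale n).
Proof. by move=> M; apply/matrixP => i j; rewrite !mxE scale1r. Qed.
Lemma matalg_scaleDr n : right_distributive (@matalg_scale n) +%R.
Proof. by move=> a M N; apply/matrixP => i j; rewrite !mxE scalerDr. Qed.
Lemma matalg_scaleDl n (M : matalg K n) :
  {morph (@matalg_scale n)^~ M : a b / a + b}.
Proof. by move=> a b; apply/matrixP => i j; rewrite !mxE scalerDl. Qed.

HB.instance Definition _ n := GRing.Zmodule_isLmodule.Build R (matalg K n)
  (@matalg_scaleA n) (@matalg_scale1 n) (@matalg_scaleDr n) (@matalg_scaleDl n).

Lemma matalg_scalerAl n (a : R) (M N : matalg K n.+1) :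
  a *: (M * N) = (a *: M) * N.
Proof.
apply/matrixP => i j; rewrite !mxE scaler_sumr; apply: eq_bigr => k _.
by rewrite !mxE scalerAl.
Qed.
HB.instance Definition _ n :=
  GRing.Lmodule_isLalgebra.Build R (matalg K n.+1) (@matalg_scalerAl n).

Lemma matalg_scalerAr n (a : R) (M N : matalg K n.+1) :
  a *: (M * N) = M * (a *: N).
Proof.
apply/matrixP => i j; rewrite !mxE scaler_sumr; apply: eq_bigr => k _.
by rewrite !mxE scalerAr.
Qed.
HB.instance Definition _ n :=
  GRing.Lalgebra_isAlgebra.Build R (matalg K n.+1) (@matalg_scalerAr n).

End MatAlg.

Definition alg_iso (R : comNzRingType) (A B : algType R) : Prop :=
  exists f : {lrmorphism A -> B}, bijective f.

(* The last case is the residue 0, i.e. s = 8 modulo 8. *)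
Definition schur_table (R : realType) (s : int) : algType R :=
  match `|(s %% 8)%Z|%N with
  | 1 => 'M[R]_2
  | 2 => matalg (Rcomplex R) 2
  | 3 => quat R
  | 4 => (quat R * quat R)%type
  | 5 => quat R
  | 6 => Rcomplex R
  | 7 => R^o
  | _ => (R^o * R^o)%type
  end.

(* Main.v *)
Require Import Defs.
From HB Require Import structures.
From mathcomp Require Import all_boot all_order all_algebra.
From mathcomp Require Import boolp reals complex ring.

Set Implicit Arguments.
Unset Strict Implicit.
Unset Printing Implicit Defensive.

Import Order.TTheory GRing.Theory Num.Theory.
Local Open Scope ring_scope.

(** An irreducible module over the Clifford algebra of signature (p, q) is a
    real vector space with pairwise anticommuting operators g_i, p of which
    have square -1 and q of which have square 1, and with no proper nonzero
    subspace stable under all of them ([clifford_system]).  The Schur algebra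
    is the algebra of the linear maps commuting with all the products g_i g_j
    ([even_comm]).  Its isomorphism type is found by moving the signature to
    one of eight small ones.

    - Let eta be the product of four operators with the same square.  Replacing
      each g_i of the four by g_i eta changes the sign of its square and keeps
      all the other relations; the stable subspaces and the commutant of the
      even products are unchanged.  Hence (p + 4, q) and (p, q + 4) have the
      same Schur algebras ([even_commutant_flipl], [even_commutant_flipr]).
    - Suppose that g_i has square -1 and g_j has square 1.  Then w = g_i g_j is
      an involution that commutes with the other operators, and these operators
      form an irreducible system of signature (p - 1, q - 1) on the space fixed
      by w.  If another operator g_k is left, then g_k g_i exchanges the two
      eigenspaces of w, and a linear map commuting with the even products is
      determined by its restriction to the fixed space of w
      ([even_commutant_step]).
    - The two moves preserve p - q modulo 8, and they reduce every signature to
      (1,0), (2,0), (3,0), (4,0), (0,1), (0,2), (0,3) or (1,1).  In these eight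
      cases the even products generate an action of D = R, C or H, possibly
      together with an involution omega commuting with it.  Irreducibility
      gives a basis over D with one or two elements, so the commutant is D
      ([rank_one_commutant]), the algebra of 2 by 2 matrices over D
      ([rank_two_commutant]) or, in the presence of omega, D * D
      ([rank_two_diag_commutant]).  The commutant of D acting on D^m is the
      algebra of matrices over the opposite of D, which is identified with D
      by an anti-involution. *)

(** * Linear maps and subspaces *)

Section Operators.
Variables (R : comNzRingType) (V : lmodType R) (f : {linear V -> V}).
Lemma oper0 : f 0 = 0. Proof. exact: raddf0. Qed.
Lemma operD u v : f (u + v) = f u + f v. Proof. exact: raddfD. Qed.
Lemma operN v : f (- v) = - f v. Proof. exact: raddfN. Qed.
Lemma operZ a v : f (a *: v) = a *: f v. Proof. exact: linearZ. Qed.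
End Operators.

Section LinearFunctions.
Variables (R : comNzRingType) (U V : lmodType R) (h : U -> V).
Hypothesis hl : linear h.
Lemma linear_fun0 : h 0 = 0.
Proof. by have := hl (-1) 0 0; rewrite scaler0 addr0 scaleN1r addNr. Qed.
Lemma linear_funD u v : h (u + v) = h u + h v.
Proof. by have := hl 1 u v; rewrite !scale1r. Qed.
Lemma linear_funZ a v : h (a *: v) = a *: h v.
Proof. by have := hl a v 0; rewrite !addr0 linear_fun0 addr0. Qed.
Lemma linear_funN v : h (- v) = - h v.
Proof. by rewrite -[- v]scaleN1r linear_funZ scaleN1r. Qed.
End LinearFunctions.

(** Linear subspaces, as propositional predicates. *)
Definition subspace (R : comNzRingType) (V : lmodType R) (W : V -> Prop) :=
  W 0 /\ forall a u v, W u -> W v -> W (a *: u + v).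

Section Subspaces.
Variables (R : comNzRingType) (V : lmodType R) (W : V -> Prop).
Hypothesis WP : subspace W.
Lemma subspaceD u v : W u -> W v -> W (u + v).
Proof. by move=> Wu Wv; rewrite -[u]scale1r; apply: WP.2. Qed.
Lemma subspaceZ a v : W v -> W (a *: v).
Proof. by move=> Wv; rewrite -[_ *: v]addr0; apply: WP.2 => //; case: WP. Qed.
Lemma subspaceN v : W v -> W (- v).
Proof. by rewrite -scaleN1r; apply: subspaceZ. Qed.
End Subspaces.

(** * Algebras of linear maps up to isomorphism *)

Section Realization.
Variables (R : comNzRingType) (V : lmodType R).

(** F is an isomorphism of R-algebras from B onto the linear maps of V into
    itself satisfying Q, with composition as product.  The maps
    satisfying Q are not packaged as a type, so that Q can be replaced by an
    equivalent condition. *)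
Record realization (Q : (V -> V) -> Prop) (B : algType R) (F : B -> V -> V) :
    Prop := Realization {
  realization_linear : forall b, linear (F b);
  realization_mem : forall b, Q (F b);
  realizationP : forall a b c v, F (a *: b + c) v = a *: F b v + F c v;
  realization1 : forall v, F 1 v = v;
  realizationM : forall b c v, F (b * c) v = F b (F c v);
  realization_inj : forall b, (forall v, F b v = 0) -> b = 0;
  realization_surj :
    forall h, linear h -> Q h -> exists b, forall v, h v = F b v }.

Definition realizes (Q : (V -> V) -> Prop) (B : algType R) :=
  exists F : B -> V -> V, realization Q F.

Lemma alg_iso_sym (A B : algType R) : alg_iso A B -> alg_iso B A.
Proof.
case=> f [g fK gK].
have gl : linear g.
  by move=> a x y; apply: (can_inj fK); rewrite linearP /= !gK.
have gm : monoid_morphism g.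
  by split=> [|x y]; apply: (can_inj fK); rewrite ?rmorph1 ?rmorphM /= !gK.
pose g1 := GRing.isLinear.Build R B A _ g gl.
pose g2 := GRing.isMonoidMorphism.Build B A g gm.
pose G : {lrmorphism B -> A} := HB.pack g g1 g2.
by exists G; exists f.
Qed.

Lemma alg_iso_trans (A B C : algType R) :
  alg_iso A B -> alg_iso B C -> alg_iso A C.
Proof.
case=> f fb [g gb]; exists (g \o f : {lrmorphism A -> C}).
exact: bij_comp.
Qed.

Lemma alg_isoP (A B : algType R) (f : A -> B) :
  linear f -> monoid_morphism f -> bijective f -> alg_iso A B.
Proof.
move=> fl fm fb.
pose g1 := GRing.isLinear.Build R A B _ f fl.
pose g2 := GRing.isMonoidMorphism.Build A B f fm.
pose G : {lrmorphism A -> B} := HB.pack f g1 g2.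
by exists G.
Qed.

Lemma realizes_iso Q (B C : algType R) :
  alg_iso C B -> realizes Q B -> realizes Q C.
Proof.
case=> f [g fK gK] [F HF].
exists (fun c => F (f c)); split=> [b|b|a b c v|v|b c v|b H|h hl Qh].
- exact: (realization_linear HF).
- exact: (realization_mem HF).
- by rewrite linearP (realizationP HF).
- by rewrite rmorph1 (realization1 HF).
- by rewrite rmorphM (realizationM HF).
- by apply: (can_inj fK); rewrite (realization_inj HF H) linear0.
- have [b hb] := realization_surj HF hl Qh.
  by exists (g b) => v; rewrite gK.
Qed.

Lemma realizes_ext (Q Q' : (V -> V) -> Prop) (B : algType R) :
  (forall h, linear h -> Q h <-> Q' h) -> realizes Q B -> realizes Q' B.
Proof.
move=> QQ' [F HF]; exists F; case: HF => H1 H2 H3 H4 H5 H6 H7; split=> //.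
- by move=> b; apply/QQ'.
- by move=> h hl Qh; apply: H7 => //; apply/QQ'.
Qed.

End Realization.

(** * The commutant of an algebra acting on a free module *)

Section FreeCommutant.
Variables (R : comNzRingType) (V : lmodType R) (D : algType R).

(** A representation of the R-algebra D on V. *)
Record is_action (rho : D -> {linear V -> V}) : Prop := IsAction {
  actionP : forall a d e v, rho (a *: d + e) v = a *: rho d v + rho e v;
  action1 : forall v, rho 1 v = v;
  actionM : forall d e v, rho (d * e) v = rho d (rho e v) }.

Variables (rho : D -> {linear V -> V}) (kappa : D -> D).
Variables (m : nat) (b : 'I_m.+1 -> V).
Hypothesis rhoP : is_action rho.

Lemma action0 v : rho 0 v = 0.
Proof.
by have := actionP rhoP (-1) 0 0 v; rewrite scaler0 addr0 scaleN1r addNr.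
Qed.
Lemma actionD d e v : rho (d + e) v = rho d v + rho e v.
Proof. by have := actionP rhoP 1 d e v; rewrite !scale1r. Qed.
Lemma actionZ a d v : rho (a *: d) v = a *: rho d v.
Proof. by have := actionP rhoP a d 0 v; rewrite !addr0 action0 addr0. Qed.
Lemma actionN d v : rho (- d) v = - rho d v.
Proof. by rewrite -[- d]scaleN1r actionZ scaleN1r. Qed.
Lemma action_sum (J : Type) (r : seq J) (P : pred J) (F : J -> D) v :
  rho (\sum_(i <- r | P i) F i) v = \sum_(i <- r | P i) rho (F i) v.
Proof.
apply: (big_morph (fun d => rho d v)); last exact: action0.
by move=> x y; exact: actionD.
Qed.

(** The D-linear combination of the family b with coefficients d. *)
Definition comb (d : 'I_m.+1 -> D) : V := \sum_i rho (d i) (b i).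

(* The next two hypotheses say that b is a basis of V over D; the following
   three, that kappa is an anti-involution of the algebra D. *)
Hypothesis comb_span : forall v, exists d, v = comb d.
Hypothesis comb_free : forall d, comb d = 0 -> forall i, d i = 0.
Hypothesis kappaK : involutive kappa.
Hypothesis kappaP : linear kappa.
Hypothesis kappaM : forall x y, kappa (x * y) = kappa y * kappa x.

Lemma combP a d e : comb (fun i => a *: d i + e i) = a *: comb d + comb e.
Proof.
rewrite /comb scaler_sumr -big_split /=; apply: eq_bigr => i _.
exact: actionP.
Qed.

Lemma comb_inj d e : comb d = comb e -> d =1 e.
Proof.
move=> de i; apply/eqP; rewrite -subr_eq0 addrC -scaleN1r; apply/eqP.
apply: (comb_free (d := fun i => -1 *: e i + d i)).
by rewrite combP de scaleN1r addNr.
Qed.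

Lemma eq_comb d e : d =1 e -> comb d = comb e.
Proof. by move=> de; apply: eq_bigr => i _; rewrite de. Qed.

Lemma rho_comb x d : rho x (comb d) = comb (fun i => x * d i).
Proof. by rewrite raddf_sum; apply: eq_bigr => i _; rewrite (actionM rhoP). Qed.

Let coor v : 'I_m.+1 -> D := projT1 (cid (comb_span v)).
Lemma coorK v : comb (coor v) = v.
Proof. by rewrite /coor; case: cid. Qed.
Lemma combK d : coor (comb d) =1 d.
Proof. exact: comb_inj (coorK _). Qed.

Let kappa1 : kappa 1 = 1.
Proof. by rewrite -[LHS]mulr1 -{2}(kappaK 1) -kappaM mulr1 kappaK. Qed.
Let kappa0 : kappa 0 = 0. Proof. exact: linear_fun0 kappaP. Qed.
Let kappaD x y : kappa (x + y) = kappa x + kappa y.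
Proof. exact: linear_funD kappaP x y. Qed.
Let kappa_sum (J : Type) (r : seq J) (P : pred J) (F : J -> D) :
  kappa (\sum_(i <- r | P i) F i) = \sum_(i <- r | P i) kappa (F i).
Proof. exact: (big_morph kappa kappaD kappa0). Qed.

(** The linear map that commutes with the action of D and sends b_j to the sum
    of the kappa (M i j) b_i.  Two maps commuting with D compose with their
    coefficients in the reverse order; kappa restores the matrix product. *)
Definition matrix_act (M : matalg D m.+1) (v : V) : V :=
  comb (fun i => \sum_j coor v j * kappa ((M : 'M_m.+1) i j)).

Lemma matrix_act_comb M d :
  matrix_act M (comb d) =
  comb (fun i => \sum_j d j * kappa ((M : 'M_m.+1) i j)).
Proof.
apply: eq_comb => i; apply: eq_bigr => j _; congr (_ * _); exact: combK.
Qed.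

Definition delta_coor (j : 'I_m.+1) : 'I_m.+1 -> D := fun i => (i == j)%:R.

Lemma comb_delta j : comb (delta_coor j) = b j.
Proof.
rewrite /comb (bigD1 j) //= big1 => [|i ij]; rewrite /delta_coor.
  by rewrite eqxx (action1 rhoP) addr0.
by rewrite (negPf ij) action0.
Qed.

Lemma matrix_act_basis M j :
  matrix_act M (b j) = comb (fun i => kappa ((M : 'M_m.+1) i j)).
Proof.
rewrite -comb_delta matrix_act_comb; apply: eq_comb => i.
rewrite (bigD1 j) //= big1 => [|k kj]; rewrite /delta_coor.
  by rewrite eqxx mul1r addr0.
by rewrite (negPf kj) mul0r.
Qed.

Lemma matrix_act_realization :
  realization (fun h => forall d v, h (rho d v) = rho d (h v)) matrix_act.
Proof.
split=> [M a u v|M d v|a M N v|v|M N v|M HM|h hl Qh].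
- rewrite -(coorK u) -(coorK v) -combP !matrix_act_comb -combP.
  apply: eq_comb => i; rewrite scaler_sumr -big_split; apply: eq_bigr => j _ /=.
  by rewrite mulrDl scalerAl.
- rewrite -(coorK v) rho_comb !matrix_act_comb rho_comb.
  apply: eq_comb => i; rewrite mulr_sumr.
  by apply: eq_bigr => j _; rewrite mulrA.
- rewrite /matrix_act -combP; apply: eq_comb => i.
  rewrite scaler_sumr -big_split; apply: eq_bigr => j _ /=.
  by rewrite !mxE kappaP mulrDr scalerAr.
- rewrite -{2}(coorK v); apply: eq_comb => i.
  rewrite (bigD1 i) //= big1 => [|k ki]; rewrite !mxE.
    by rewrite eqxx kappa1 mulr1 addr0.
  by rewrite eq_sym (negPf ki) kappa0 mulr0.
- rewrite -(coorK v) !matrix_act_comb; apply: eq_comb => i.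
  under eq_bigr => j _ do rewrite !mxE kappa_sum mulr_sumr.
  rewrite exchange_big; apply: eq_bigr => k _; rewrite mulr_suml.
  by apply: eq_bigr => j _; rewrite kappaM mulrA.
- apply/matrixP => i j; rewrite !mxE.
  have := HM (b j); rewrite matrix_act_basis => /comb_free /(_ i) H.
  by rewrite -[LHS]kappaK H kappa0.
- pose M : matalg D m.+1 := \matrix_(i, j) kappa (coor (h (b j)) i).
  exists M => v; rewrite -(coorK v) /comb.
  rewrite (big_morph h (linear_funD hl) (linear_fun0 hl)).
  under eq_bigr => j _ do rewrite Qh -(coorK (h (b j))) rho_comb.
  rewrite exchange_big /= matrix_act_comb; apply: eq_bigr => i _.
  rewrite -action_sum; congr (rho _ _); apply: eq_bigr => j _.
  by rewrite /M !mxE kappaK.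
Qed.

End FreeCommutant.

(** * Irreducible actions of rank one and two *)

Section RankOneTwo.
Variables (R : realType) (V : lmodType R) (D : algType R).
Variables (rho : D -> {linear V -> V}) (kappa : D -> D).
Hypothesis rhoP : is_action rho.
Hypothesis kappaK : involutive kappa.
Hypothesis kappaP : linear kappa.
Hypothesis kappaM : forall x y, kappa (x * y) = kappa y * kappa x.
Hypothesis D_div : forall d : D, d != 0 -> exists e, e * d = 1.

Variable tau : {linear V -> V}.
Hypothesis V_neq0 : exists v : V, v != 0.

(** No proper nonzero subspace is stable under D, tau and omega. *)
Definition irreducible_with (omega : V -> V) :=
  forall W : V -> Prop, subspace W ->
  (forall d v, W v -> W (rho d v)) -> (forall v, W v -> W (tau v)) ->
  (forall v, W v -> W (omega v)) ->
  (forall v, W v -> v = 0) \/ (forall v, W v).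

Definition rho_comm (h : V -> V) := forall d v, h (rho d v) = rho d (h v).

Lemma rho_free d v : v != 0 -> rho d v = 0 -> d = 0.
Proof.
move=> v0 dv; apply/eqP/negPn/negP => /D_div[e ed]; case/eqP: v0.
by rewrite -(action1 rhoP v) -ed (actionM rhoP) dv raddf0.
Qed.

Lemma matalg1_iso : alg_iso D (matalg D 1).
Proof.
apply: (@alg_isoP _ _ _ (fun d => const_mx d : matalg D 1)).
- by move=> a x y; apply/matrixP => i j; rewrite !mxE.
- split=> [|x y]; apply/matrixP => i j; rewrite !mxE ?ord1 ?eqxx //.
  by rewrite big_ord1 !mxE.
- exists (fun M : matalg D 1 => (M : 'M_1) 0 0) => [x|M]; rewrite ?mxE //.
  by apply/matrixP => i j; rewrite !mxE !ord1.
Qed.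

(** As tau is an involution, it has an eigenvector v; the line D v is stable,
    hence equal to V. *)
Lemma rank_one_commutant (sigma : D -> D) :
  irreducible_with id -> (forall v, tau (tau v) = v) ->
  (forall d v, tau (rho d v) = rho (sigma d) (tau v)) ->
  realizes rho_comm D.
Proof.
move=> irr tauK tau_rho; apply: (realizes_iso matalg1_iso).
have [v [e [v0 tv]]] : exists v e, v != 0 /\ tau v = e *: v.
  have [u u0] := V_neq0; have [E|E] := eqVneq (u + tau u) 0.
    exists u, (-1); split=> //; rewrite scaleN1r; apply/eqP.
    by rewrite -addr_eq0 addrC E.
  by exists (u + tau u), 1; split=> //; rewrite scale1r raddfD /= tauK addrC.
pose b (i : 'I_1) := v.
have combE d : comb rho b d = rho (d 0) v by rewrite /comb big_ord1.
have span u : exists d, u = comb rho b d.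
  suff [d ->] : exists d, u = rho d v by exists (fun=> d); rewrite combE.
  have [||||H|//] := irr (fun u => exists d, u = rho d v).
  - split=> [|a _ _ [d ->] [d' ->]]; first by exists 0; rewrite (action0 rhoP).
    by exists (a *: d + d'); rewrite (actionP rhoP).
  - by move=> d _ [d' ->]; exists (d * d'); rewrite (actionM rhoP).
  - move=> _ [d ->]; exists (e *: sigma d).
    by rewrite tau_rho tv linearZ /= (actionZ rhoP).
  - by [].
  - case/eqP: v0; apply: H; exists 1; rewrite (action1 rhoP) //.
have free d : comb rho b d = 0 -> forall i, d i = 0.
  by rewrite combE => /(rho_free v0) H i; rewrite ord1.
by eexists; exact: (matrix_act_realization rhoP span free kappaK kappaP kappaM).
Qed.

Let lift0_ord2 : lift 0 0 = 1 :> 'I_2. Proof. exact: val_inj. Qed.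

(** Two vectors that generate V over the division algebra D and are not
    proportional form a basis. *)
Lemma rank_two_basis v w : v != 0 -> w != 0 ->
  (forall W : V -> Prop, subspace W -> (forall d u, W u -> W (rho d u)) ->
     W v -> W w -> forall u, W u) ->
  (forall d, w != rho d v) ->
  let b (i : 'I_2) := if i == 0 then v else w in
  (forall u, exists d, u = comb rho b d) /\
  (forall d, comb rho b d = 0 -> forall i, d i = 0).
Proof.
move=> v0 w0 gen ind b.
have combE d : comb rho b d = rho (d 0) v + rho (d 1) w.
  by rewrite /comb big_ord_recl big_ord1 lift0_ord2.
split=> [u|d].
  suff [d [d' ->]] : exists d d', u = rho d v + rho d' w.
    by exists (fun i => if i == 0 then d else d'); rewrite combE.
  apply: (gen (fun u => exists d d', u = rho d v + rho d' w)).
  - split=> [|a _ _ [d [d' ->]] [e [e' ->]]].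
      by exists 0, 0; rewrite !(action0 rhoP) addr0.
    exists (a *: d + e), (a *: d' + e').
    by rewrite !(actionP rhoP) scalerDr addrACA.
  - move=> d _ [e [e' ->]]; exists (d * e), (d * e').
    by rewrite !(actionM rhoP) raddfD.
  - by exists 1, 0; rewrite (action1 rhoP) (action0 rhoP) addr0.
  - by exists 0, 1; rewrite (action1 rhoP) (action0 rhoP) add0r.
rewrite combE => E.
have d10 : d 1 = 0.
  apply/eqP/negPn/negP => /D_div[e ed]; case/eqP: (ind (- (e * d 0))).
  rewrite (actionN rhoP) (actionM rhoP) -[w](action1 rhoP) -ed (actionM rhoP).
  by apply/eqP; rewrite -addr_eq0 addrC -raddfD /= E raddf0.
have d00 : d 0 = 0.
  by move: E; rewrite d10 (action0 rhoP) addr0 => /(rho_free v0).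
by move=> i; case: (unliftP 0 i) => [j ->|->] //; rewrite ord1 lift0_ord2.
Qed.

(** If tau v were equal to d v with v nonzero, then applying tau again would
    give sigma d * d = -1.  So v and tau v form a basis for every nonzero v. *)
Lemma rank_two_commutant (sigma : D -> D) :
  irreducible_with id -> (forall v, tau (tau v) = - v) ->
  (forall d v, tau (rho d v) = rho (sigma d) (tau v)) ->
  (forall d, sigma d * d != -1) ->
  realizes rho_comm (matalg D 2).
Proof.
move=> irr tauK tau_rho sigma_neqN1; have [v v0] := V_neq0.
have tv0 : tau v != 0.
  apply: contra_neq v0 => tv0; apply/eqP.
  by rewrite -oppr_eq0 -tauK tv0 raddf0.
have gen (W : V -> Prop) : subspace W -> (forall d u, W u -> W (rho d u)) ->
    W v -> W (tau v) -> forall u, W u.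
  move=> WP Wrho Wv Wtv; case: (WP) => W0 WD; pose W' u := W u /\ W (tau u).
  have [||||H|H u] := irr W'.
  - split=> [|a x y [Wx Wtx] [Wy Wty]]; first by split; rewrite ?raddf0.
    by split; rewrite ?linearP; apply: WD.
  - by move=> d x [Wx Wtx]; split; rewrite ?tau_rho; apply: Wrho.
  - by move=> x [Wx Wtx]; split; rewrite ?tauK //; apply: subspaceN.
  - by [].
  - by case/eqP: v0; apply: H.
  - by case: (H u).
have [|span free] := rank_two_basis v0 tv0 gen.
  move=> d; apply: contra_neq (sigma_neqN1 d) => tv.
  apply/eqP; rewrite -subr_eq0 opprK; apply/eqP/(rho_free v0).
  rewrite (actionD rhoP) (actionM rhoP) -tv -tau_rho -tv tauK.
  by rewrite (action1 rhoP) addNr.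
by eexists; exact: (matrix_act_realization rhoP span free kappaK kappaP kappaM).
Qed.

Let diag2 (x : D * D) : 'M[D]_2 := diag_mx (\row_i if i == 0 then x.1 else x.2).

(** A vector v fixed by omega and its image tau v, on which omega is -1, form a
    basis over D; commuting with omega means that the matrix is diagonal. *)
Lemma rank_two_diag_commutant (omega : {linear V -> V}) (c : R) :
  irreducible_with omega -> (forall v, omega (omega v) = v) ->
  c != 0 -> (forall v, tau (tau v) = c *: v) ->
  (forall v, tau (omega v) = - omega (tau v)) ->
  (forall d v, omega (rho d v) = rho d (omega v)) ->
  (forall d v, tau (rho d v) = rho d (tau v)) ->
  realizes (fun h => rho_comm h /\ forall v, h (omega v) = omega (h v))
    (D * D)%type.
Proof.
move=> irr omegaK c0 tauK tau_omega omega_rho tau_rho.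
have tau_neq0 v : v != 0 -> tau v != 0.
  apply: contra_neq => tv0; apply/eqP.
  have := tauK v; rewrite tv0 raddf0 => /esym/eqP.
  by rewrite scaler_eq0 (negPf c0).
have [v [v0 ov]] : exists v, v != 0 /\ omega v = v.
  have [u u0] := V_neq0; have [E|E] := eqVneq (u + omega u) 0.
    exists (tau u); split; first exact: tau_neq0.
    move/eqP: E; rewrite addrC addr_eq0 => /eqP ou.
    by rewrite -[LHS]opprK -tau_omega ou raddfN opprK.
  by exists (u + omega u); split=> //; rewrite raddfD /= omegaK addrC.
have tv0 := tau_neq0 _ v0.
have otv : omega (tau v) = - tau v by rewrite -{2}ov tau_omega opprK.
have gen (W : V -> Prop) : subspace W -> (forall d u, W u -> W (rho d u)) ->
    W v -> W (tau v) -> forall u, W u.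
  move=> [W0 WD] Wrho Wv Wtv.
  pose W' u := exists d d', u = rho d v + rho d' (tau v).
  have [||||H|H u] := irr W'.
  - split=> [|a _ _ [d [d' ->]] [e [e' ->]]].
      by exists 0, 0; rewrite !(action0 rhoP) addr0.
    exists (a *: d + e), (a *: d' + e').
    by rewrite !(actionP rhoP) scalerDr addrACA.
  - move=> d _ [e [e' ->]]; exists (d * e), (d * e').
    by rewrite !(actionM rhoP) raddfD.
  - move=> _ [d [d' ->]]; exists (c *: d'), d.
    by rewrite raddfD /= !tau_rho tauK linearZ /= (actionZ rhoP) addrC.
  - move=> _ [d [d' ->]]; exists d, (- d').
    by rewrite raddfD /= !omega_rho ov otv raddfN (actionN rhoP).
  - case/eqP: v0; apply: H; exists 1, 0.
    by rewrite (action1 rhoP) (action0 rhoP) addr0.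
  have [d [d' ->]] := H u; rewrite -[rho d v]scale1r; apply: WD; exact: Wrho.
have ind d : tau v != rho d v.
  apply: contra_neq tv0 => tv; have := otv.
  rewrite {1}tv omega_rho ov -tv => /eqP.
  by rewrite -addr_eq0 -mulr2n -scaler_nat scaler_eq0 pnatr_eq0 /= => /eqP.
have [span free] := rank_two_basis v0 tv0 gen ind.
pose b (i : 'I_2) := if i == 0 then v else tau v.
rewrite -/b in span free.
have [F [FR Fb]] : exists F : matalg D 2 -> V -> V, realization rho_comm F /\
    forall M j, F M (b j) = comb rho b (fun i => kappa ((M : 'M_2) i j)).
  exists (matrix_act kappa span); split; last exact: matrix_act_basis.
  exact: matrix_act_realization.
have combE d : comb rho b d = rho (d 0) v + rho (d 1) (tau v).
  by rewrite /comb big_ord_recl big_ord1 lift0_ord2.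
have Fv (M : 'M[D]_2) :
    F M v = rho (kappa (M 0 0)) v + rho (kappa (M 1 0)) (tau v).
  by rewrite -[in LHS](erefl : b 0 = v) Fb combE.
have Ftv (M : 'M[D]_2) :
    F M (tau v) = rho (kappa (M 0 1)) v + rho (kappa (M 1 1)) (tau v).
  by rewrite -[in LHS](erefl : b 1 = tau v) Fb combE.
have kappa0 := linear_fun0 kappaP.
have Flin M : linear (F M) := realization_linear FR M.
have Frho M d u : F M (rho d u) = rho d (F M u) := realization_mem FR M d u.
have FD M x y : F M (x + y) = F M x + F M y := linear_funD (Flin M) x y.
have FN M x : F M (- x) = - F M x := linear_funN (Flin M) x.
have d00 x : diag2 x 0 0 = x.1 by rewrite /diag2 !mxE eqxx.
have d11 x : diag2 x 1 1 = x.2 by rewrite /diag2 !mxE eqxx.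
have d01 x : diag2 x 0 1 = 0 by rewrite /diag2 !mxE.
have d10 x : diag2 x 1 0 = 0 by rewrite /diag2 !mxE.
have eq2 (M N : 'M[D]_2) : M 0 0 = N 0 0 -> M 0 1 = N 0 1 -> M 1 0 = N 1 0 ->
    M 1 1 = N 1 1 -> M = N.
  move=> E00 E01 E10 E11; apply/matrixP => i j.
  by case: (unliftP 0 i) => [i' ->|->]; case: (unliftP 0 j) => [j' ->|->];
    rewrite ?ord1 ?lift0_ord2.
exists (fun x => F (diag2 x)).
split=> [x|x|a x y u|u|x y u|x H|h hl [hrho homega]].
- exact: Flin.
- split=> [d u|u]; first exact: Frho.
  have [d ->] := span u.
  rewrite combE raddfD /= !FD !omega_rho ov otv raddfN FN.
  rewrite !Frho Fv Ftv d01 d10 kappa0 !(action0 rhoP) add0r addr0 d00 d11.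
  by rewrite raddfD /= !omega_rho ov otv !raddfN.
- rewrite -(realizationP FR); congr (F _ u); apply: eq2;
    by rewrite !mxE ?scaler0 ?addr0.
- rewrite -[RHS](realization1 FR); congr (F _ u); apply: eq2;
    by rewrite !mxE.
- rewrite -(realizationM FR); congr (F _ u).
  rewrite /diag2 -[RHS]/(diag_mx _ *m diag_mx _) mulmx_diag.
  by congr diag_mx; apply/rowP => i; rewrite !mxE; case: ifP.
- have E := realization_inj FR H.
  case: x {H} E => x y /matrixP E; congr pair.
    by have := E 0 0; rewrite /diag2 !mxE eqxx.
  by have := E 1 1; rewrite /diag2 !mxE eqxx.
- have [M hM] := realization_surj FR hl hrho.
  have M10 : M 1 0 = 0.
    rewrite -[LHS]kappaK; have := homega v; rewrite !hM ov Fv.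
    rewrite [omega (_ + _)]raddfD /= !omega_rho ov otv.
    move/addrI/eqP; rewrite raddfN -addr_eq0 -mulr2n -scaler_nat scaler_eq0.
    by rewrite pnatr_eq0 /= => /eqP/(rho_free tv0) ->.
  have M01 : M 0 1 = 0.
    rewrite -[LHS]kappaK; have := homega (tau v); rewrite !hM otv FN Ftv.
    rewrite [omega (_ + _)]raddfD /= !omega_rho ov otv.
    rewrite raddfN opprD => /addIr/esym/eqP.
    rewrite -addr_eq0 -mulr2n -scaler_nat scaler_eq0.
    by rewrite pnatr_eq0 /= => /eqP/(rho_free v0) ->.
  exists (M 0 0, M 1 1) => u; rewrite hM; congr (F _ u).
  by apply: eq2; rewrite ?d00 ?d01 ?d10 ?d11.
Qed.

End RankOneTwo.

(** * Actions of the reals, the complex numbers and the quaternions *)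

Section Actions.
Variables (R : realType) (V : lmodType R).

Definition real_act (d : R^o) : {linear V -> V} := *:%R (d : R).

Lemma real_actP : is_action real_act.
Proof.
split=> [a d e v|v|d e v]; rewrite /real_act /=.
- by rewrite scalerDl scalerA.
- by rewrite scale1r.
- by rewrite scalerA.
Qed.

(** The action of the complex numbers in which i acts as J. *)
Definition complex_act (J : {linear V -> V}) (z : Rcomplex R) :
    {linear V -> V} :=
  (complex.Re z \*: idfun \+ complex.Im z \*: J).

Lemma complex_actE J z v :
  complex_act J z v = complex.Re z *: v + complex.Im z *: J v.
Proof. by []. Qed.

Lemma complex_actP (J : {linear V -> V}) :
  (forall v, J (J v) = - v) -> is_action (complex_act J).
Proof.
move=> JK; pose q (a b : R) v := a *: v + b *: J v.
have qD a b a' b' v : q a b v + q a' b' v = q (a + a') (b + b') v.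
  by rewrite /q !scalerDl addrACA.
have qZ t a b v : t *: q a b v = q (t * a) (t * b) v.
  by rewrite /q scalerDr !scalerA.
have qJ a b v : J (q a b v) = q (- b) a v.
  by rewrite /q !(operD J) !(operZ J) JK scalerN scaleNr addrC.
have actE z v : complex_act J z v = q (complex.Re z) (complex.Im z) v by [].
split=> [a [d d'] [e e'] v|v|[d d'] [e e'] v].
- by rewrite !actE qZ qD.
- by rewrite actE /q /= scale1r scale0r addr0.
- rewrite [LHS]actE [X in _ = _ X]actE actE [RHS]/q qJ !qZ qD.
  by congr q; rewrite /=; ring.
Qed.

(** The action of the quaternions in which i acts as I and j acts as J. *)
Definition quat_act (I J : {linear V -> V}) (x : quat R) : {linear V -> V} :=
  quat_re x \*: idfun \+ quat_i x \*: I \+ quat_j x \*: J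
    \+ quat_k x \*: (I \o J).

Lemma quat_actE I J x v : quat_act I J x v =
  quat_re x *: v + quat_i x *: I v + quat_j x *: J v + quat_k x *: I (J v).
Proof. by []. Qed.

Lemma quat_actP (I J : {linear V -> V}) :
  (forall v, I (I v) = - v) -> (forall v, J (J v) = - v) ->
  (forall v, J (I v) = - I (J v)) -> is_action (quat_act I J).
Proof.
move=> IK JK JI.
pose q (a b c d : R) v := a *: v + b *: I v + c *: J v + d *: I (J v).
have qD a b c d a' b' c' d' v :
    q a b c d v + q a' b' c' d' v = q (a + a') (b + b') (c + c') (d + d') v.
  rewrite /q !scalerDl [LHS]addrACA; congr (_ + _).
  by rewrite [LHS]addrACA; congr (_ + _); exact: addrACA.
have qZ t a b c d v : t *: q a b c d v = q (t * a) (t * b) (t * c) (t * d) v.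
  by rewrite /q !scalerDr !scalerA.
have qI a b c d v : I (q a b c d v) = q (- b) a (- d) c v.
  rewrite /q !(operD I) !(operZ I) !IK !scalerN !scaleNr.
  by rewrite [a *: _ + _]addrC -[LHS]addrA [c *: _ + _]addrC addrA.
have qJ a b c d v : J (q a b c d v) = q (- c) d a (- b) v.
  rewrite /q !(operD J) !(operZ J) !JI !JK (operN I) opprK !scalerN !scaleNr.
  by rewrite -addrA addrC addrA.
have actE x v :
    quat_act I J x v = q (quat_re x) (quat_i x) (quat_j x) (quat_k x) v.
  by [].
split=> [a [x1 x2 x3 x4] [y1 y2 y3 y4] v|v|[x1 x2 x3 x4] [y1 y2 y3 y4] v].
- by rewrite !actE qZ qD.
- by rewrite actE /q /= scale1r !scale0r !addr0.
- rewrite [LHS]actE [X in _ = _ X]actE actE [RHS]/q qJ !qI !qZ !qD.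
  congr q; rewrite /=; ring.
Qed.

End Actions.

Section DivisionAlgebras.
Variable R : realType.

Lemma real_div (d : R^o) : d != 0 -> exists e : R^o, e * d = 1.
Proof. by move=> d0; exists (d^-1); rewrite mulVf. Qed.

Lemma complex_div (d : Rcomplex R) : d != 0 -> exists e : Rcomplex R, e * d = 1.
Proof. by move=> d0; exists (d^-1); apply: mulVf. Qed.

Lemma real_involution : [/\ involutive (@id R^o), linear (@id R^o) &
  forall x y : R^o, id (x * y) = id y * id x].
Proof. by split=> // x y; rewrite mulrC. Qed.

Lemma complex_involution :
  [/\ involutive (@id (Rcomplex R)), linear (@id (Rcomplex R)) &
  forall x y : Rcomplex R, id (x * y) = id y * id x].
Proof. by split=> // x y; rewrite mulrC. Qed.

Definition quat_conj (x : quat R) : quat R :=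
  let: Quat a b c d := x in Quat a (- b) (- c) (- d).

Lemma quat_involution : [/\ involutive quat_conj, linear quat_conj &
  forall x y, quat_conj (x * y) = quat_conj y * quat_conj x].
Proof.
split=> [[a b c d]|t [a b c d] [a' b' c' d']|[a b c d] [a' b' c' d']];
  by congr Quat; ring.
Qed.

Lemma quat_div (x : quat R) : x != 0 -> exists y, y * x = 1.
Proof.
case: x => a b c d x0; pose n := a ^+ 2 + b ^+ 2 + c ^+ 2 + d ^+ 2.
have n0 : n != 0.
  apply: contra_neq x0 => /eqP; rewrite /n !paddr_eq0 ?addr_ge0 ?sqr_ge0 //.
  by rewrite !sqrf_eq0 => /andP[/andP[/andP[/eqP-> /eqP->] /eqP->] /eqP->].
exists (n^-1 *: quat_conj (Quat a b c d)); rewrite -scalerAl.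
congr Quat; rewrite /=; try by ring.
by rewrite -(mulVf n0) /n; ring.
Qed.

Lemma complex_conj_normN1 (d : Rcomplex R) : (conjc d : Rcomplex R) * d != -1.
Proof.
case: d => a b; apply/eqP => -[] /eqP; rewrite mulNr opprK -!expr2 => H _.
have: -1 >= 0 :> R by rewrite -(eqP H) addr_ge0 // sqr_ge0.
by rewrite oppr_ge0 ler10.
Qed.

Lemma real_sqrN1 (d : R^o) : d * d != -1.
Proof.
apply/eqP => H; have: -1 >= 0 :> R by rewrite -H -expr2 sqr_ge0.
by rewrite oppr_ge0 ler10.
Qed.

Lemma matalg_real_iso n : alg_iso 'M[R]_n.+1 (matalg R^o n.+1).
Proof.
apply: (@alg_isoP _ _ _ (fun M : 'M[R]_n.+1 => M : matalg R^o n.+1)).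
- by move=> a x y; apply/matrixP => i j; rewrite !mxE.
- by [].
- by exists id.
Qed.

End DivisionAlgebras.

Section ActionCommutants.
Variables (R : realType) (V : lmodType R).
Implicit Type h : V -> V.

Lemma real_act_comm h : linear h -> rho_comm (@real_act R V) h.
Proof. by move=> hl d v; apply: linear_funZ. Qed.

Lemma complex_act_comm (J : {linear V -> V}) h : linear h ->
  rho_comm (complex_act J) h <-> (forall v, h (J v) = J (h v)).
Proof.
move=> hl; split=> [H v|H d v].
  by have := H (0 +i* 1)%C v; rewrite !complex_actE /= !scale0r !add0r !scale1r.
by rewrite !complex_actE (linear_funD hl) !(linear_funZ hl) H.
Qed.

Lemma quat_act_comm (I J : {linear V -> V}) h : linear h ->
  rho_comm (quat_act I J) h <->
  (forall v, h (I v) = I (h v)) /\ (forall v, h (J v) = J (h v)).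
Proof.
move=> hl; split=> [H|[HI HJ] d v].
  split=> v.
    have := H (Quat 0 1 0 0) v.
    by rewrite !quat_actE /= !scale0r !addr0 !add0r !scale1r.
  have := H (Quat 0 0 1 0) v.
  by rewrite !quat_actE /= !scale0r !addr0 !add0r !scale1r.
by rewrite !quat_actE !(linear_funD hl) !(linear_funZ hl) !HI HJ.
Qed.

Lemma complex_act_stable (J : {linear V -> V}) (W : V -> Prop) :
  (forall d v, W v -> W (complex_act J d v)) -> forall v, W v -> W (J v).
Proof.
move=> H v /(H (0 +i* 1)%C).
by rewrite complex_actE /= scale0r add0r scale1r.
Qed.

Lemma quat_act_stable (I J : {linear V -> V}) (W : V -> Prop) :
  (forall d v, W v -> W (quat_act I J d v)) ->
  (forall v, W v -> W (I v)) /\ (forall v, W v -> W (J v)).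
Proof.
move=> H; split=> v Wv.
  have := H (Quat 0 1 0 0) v Wv.
  by rewrite !quat_actE /= !scale0r !addr0 !add0r !scale1r.
have := H (Quat 0 0 1 0) v Wv.
by rewrite !quat_actE /= !scale0r !addr0 !add0r !scale1r.
Qed.

End ActionCommutants.

(** * Clifford systems and the eight smallest signatures *)

Section CliffordSystems.
Variables (R : realType) (I : finType).

(** An irreducible family of pairwise anticommuting operators g i on V, for i in
    A, with (g i)^2 = -1 if s i and (g i)^2 = 1 otherwise.  The values of g and
    s outside A play no role. *)
Record clifford_system (V : lmodType R) (A : {set I}) (s : I -> bool)
    (g : I -> {linear V -> V}) : Prop := CliffordSystem {
  system_sqr : forall i, i \in A -> forall v, g i (g i v) = (-1) ^+ s i *: v;
  system_anti : forall i j, i \in A -> j \in A -> i != j ->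
    forall v, g i (g j v) = - g j (g i v);
  system_neq0 : exists v : V, v != 0;
  system_irr : forall W : V -> Prop, subspace W ->
    (forall i, i \in A -> forall v, W v -> W (g i v)) ->
    (forall v, W v -> v = 0) \/ (forall v, W v) }.

(** h commutes with the products of two of the operators, hence with all the
    products of an even number of them. *)
Definition even_comm (V : lmodType R) (A : {set I}) (g : I -> {linear V -> V})
    (h : V -> V) : Prop :=
  forall i j, i \in A -> j \in A -> forall v, h (g i (g j v)) = g i (g j (h v)).

(** For every irreducible system with p squares -1 and q squares 1, the
    commutant of the even products is isomorphic to B. *)
Definition even_commutant (p q : nat) (B : algType R) : Prop :=
  forall (V : lmodType R) (A : {set I}) (s : I -> bool)
    (g : I -> {linear V -> V}),
    #|[set i in A | s i]| = p -> #|[set i in A | ~~ s i]| = q ->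
    clifford_system A s g -> realizes (even_comm A g) B.

(** The products g_i g_k with k fixed suffice: g_i g_j is g_i g_k g_k g_j up to
    sign. *)
Lemma even_comm_pivot (V : lmodType R) (A : {set I}) (s : I -> bool)
    (g : I -> {linear V -> V}) k h :
  clifford_system A s g -> linear h -> k \in A ->
  (forall i, i \in A -> i != k ->
    forall v, h (g i (g k v)) = g i (g k (h v))) ->
  even_comm A g h.
Proof.
move=> sys hl kA hk.
have sgnK (b : bool) (v : V) : (-1) ^+ b *: ((-1) ^+ b *: v) = v.
  by rewrite scalerA -expr2 sqrr_sign scale1r.
have hsq i : i \in A -> forall v, h (g i (g i v)) = g i (g i (h v)).
  by move=> iA v; rewrite !(system_sqr sys) // linear_funZ.
have hki i : i \in A -> forall v, h (g i (g k v)) = g i (g k (h v)).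
  by move=> iA v; have [->|ik] := eqVneq i k; [exact: hsq|exact: hk].
have hik i : i \in A -> forall v, h (g k (g i v)) = g k (g i (h v)).
  move=> iA v; have [->|ik] := eqVneq i k; first exact: hsq.
  rewrite eq_sym in ik.
  by rewrite !(system_anti sys kA iA ik) (linear_funN hl) hki.
move=> i j iA jA v.
have E u : g j u = (-1) ^+ s k *: g k (g k (g j u)).
  by rewrite (system_sqr sys) // sgnK.
by rewrite (E v) (E (h v)) !operZ (linear_funZ hl) hki // hik.
Qed.

Lemma set_enum_card n (A : {set I}) :
  #|A| = n -> exists2 t : seq I, uniq t /\ size t = n & A =i t.
Proof.
move=> An; exists (enum A); first by rewrite enum_uniq -cardE.
by move=> i; rewrite mem_enum.
Qed.

Lemma negative_enum (A : {set I}) (s : I -> bool) n :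
  #|[set i in A | s i]| = n -> #|[set i in A | ~~ s i]| = 0 ->
  exists t, [/\ uniq t, size t = n, forall i, i \in t -> i \in A /\ s i &
    forall i, i \in A -> i \in t].
Proof.
move=> /set_enum_card[t [ut st] At] /eqP; rewrite cards_eq0 => /eqP A0.
exists t; split=> // i; first by rewrite -At inE => /andP[].
rewrite -At inE; have := in_set0 i; rewrite -A0 inE.
by case: (i \in A) (s i) => [] [].
Qed.

Lemma positive_enum (A : {set I}) (s : I -> bool) n :
  #|[set i in A | s i]| = 0 -> #|[set i in A | ~~ s i]| = n ->
  exists t, [/\ uniq t, size t = n,
    forall i, i \in t -> i \in A /\ s i = false &
    forall i, i \in A -> i \in t].
Proof.
move=> A0 An.
have [|t [ut st At tA]] := @negative_enum A (negb \o s) n An.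
  by rewrite -A0; apply: eq_card => i; rewrite !inE /= negbK.
by exists t; split=> // i /At[iA /negPf].
Qed.

Lemma even_commutant_1_0 : even_commutant 1 0 'M[R]_2.
Proof.
move=> V A s g cp cq sys; have [t [ut st At tA]] := negative_enum cp cq.
case: t ut st At tA => [|i []] // _ _ At tA.
have [iA si] := At i (mem_head _ _).
have sq v : g i (g i v) = - v by rewrite (system_sqr sys) // si expr1 scaleN1r.
have [rK rl rM] := real_involution R.
apply: realizes_iso (matalg_real_iso R 1) _.
apply: (@realizes_ext _ _ (rho_comm (@real_act R V))).
  move=> h hl; split=> _; last exact: real_act_comm.
  apply: (even_comm_pivot sys hl iA) => j.
  by move=> /tA; rewrite inE => /eqP ->; rewrite eqxx.
apply: (rank_two_commutant (real_actP V) rK rl rM (@real_div R) (tau := g i)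
  (system_neq0 sys) (sigma := id)).
- move=> W WP _ Wi _; apply: (system_irr sys WP) => j.
  by move=> /tA; rewrite inE => /eqP ->.
- exact: sq.
- by move=> d v; rewrite /real_act /= operZ.
- exact: real_sqrN1.
Qed.

Lemma even_commutant_0_1 : even_commutant 0 1 R^o.
Proof.
move=> V A s g cp cq sys; have [t [ut st At tA]] := positive_enum cp cq.
case: t ut st At tA => [|i []] // _ _ At tA.
have [iA si] := At i (mem_head _ _).
have sq v : g i (g i v) = v by rewrite (system_sqr sys) // si scale1r.
have [rK rl rM] := real_involution R.
apply: (@realizes_ext _ _ (rho_comm (@real_act R V))).
  move=> h hl; split=> _; last exact: real_act_comm.
  apply: (even_comm_pivot sys hl iA) => j.
  by move=> /tA; rewrite inE => /eqP ->; rewrite eqxx.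
apply: (rank_one_commutant (real_actP V) rK rl rM (@real_div R) (tau := g i)
  (system_neq0 sys) (sigma := id)).
- move=> W WP _ Wi _; apply: (system_irr sys WP) => j.
  by move=> /tA; rewrite inE => /eqP ->.
- exact: sq.
- by move=> d v; rewrite /real_act /= operZ.
Qed.

(** In signatures (2,0) and (0,2) the even products are generated by J =
    g_i g_j, which has square -1 and anticommutes with tau = g_i. *)
Lemma even_commutant_2_0 : even_commutant 2 0 (matalg (Rcomplex R) 2).
Proof.
move=> V A s g cp cq sys; have [t [ut st At tA]] := negative_enum cp cq.
case: t ut st At tA => [|i [|j []]] //; rewrite /= inE andbT => ij _ At tA.
have [iA si] : i \in A /\ s i by apply: At; rewrite !inE eqxx.
have [jA sj] : j \in A /\ s j by apply: At; rewrite !inE eqxx orbT.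
have sqi v : g i (g i v) = - v by rewrite (system_sqr sys) // si scaleN1r.
have sqj v : g j (g j v) = - v by rewrite (system_sqr sys) // sj scaleN1r.
have ji v : g j (g i v) = - g i (g j v) by rewrite (system_anti sys) // eq_sym.
pose J : {linear V -> V} := g i \o g j.
have JK v : J (J v) = - v by rewrite /= !(ji, sqi, sqj, operN (g i), opprK).
have [cK cl cM] := complex_involution R.
apply: (@realizes_ext _ _ (rho_comm (complex_act J))).
  move=> h hl; rewrite complex_act_comm //; split=> H; last first.
    by move=> v; apply: H.
  apply: (even_comm_pivot sys hl jA) => k /tA.
  by rewrite !inE => /orP[]/eqP ->; [move=> _; exact: H|rewrite eqxx].
apply: (rank_two_commutant (complex_actP JK) cK cl cM (@complex_div R)
  (tau := g i) (system_neq0 sys) (sigma := @conjc R)).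
- move=> W WP Wrho Wi _; apply: (system_irr sys WP) => k /tA.
  rewrite !inE => /orP[]/eqP -> // v Wv.
  rewrite -[g j v]opprK -(sqi (g j v)); apply: (subspaceN WP); apply: Wi.
  exact: (complex_act_stable Wrho).
- exact: sqi.
- case=> a b v; rewrite !complex_actE /= (operD (g i)) !(operZ (g i)).
  by rewrite !(ji, sqi, operN (g i)) opprK scaleNr scalerN.
- exact: complex_conj_normN1.
Qed.

Lemma even_commutant_0_2 : even_commutant 0 2 (Rcomplex R).
Proof.
move=> V A s g cp cq sys; have [t [ut st At tA]] := positive_enum cp cq.
case: t ut st At tA => [|i [|j []]] //; rewrite /= inE andbT => ij _ At tA.
have [iA si] : i \in A /\ s i = false by apply: At; rewrite !inE eqxx.
have [jA sj] : j \in A /\ s j = false by apply: At; rewrite !inE eqxx orbT.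
have sqi v : g i (g i v) = v by rewrite (system_sqr sys) // si scale1r.
have sqj v : g j (g j v) = v by rewrite (system_sqr sys) // sj scale1r.
have ji v : g j (g i v) = - g i (g j v) by rewrite (system_anti sys) // eq_sym.
pose J : {linear V -> V} := g i \o g j.
have JK v : J (J v) = - v by rewrite /= !(ji, sqi, sqj, operN (g i)).
have [cK cl cM] := complex_involution R.
apply: (@realizes_ext _ _ (rho_comm (complex_act J))).
  move=> h hl; rewrite complex_act_comm //; split=> H; last first.
    by move=> v; apply: H.
  apply: (even_comm_pivot sys hl jA) => k /tA.
  by rewrite !inE => /orP[]/eqP ->; [move=> _; exact: H|rewrite eqxx].
apply: (rank_one_commutant (complex_actP JK) cK cl cM (@complex_div R)
  (tau := g i) (system_neq0 sys) (sigma := @conjc R)).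
- move=> W WP Wrho Wi _; apply: (system_irr sys WP) => k /tA.
  rewrite !inE => /orP[]/eqP -> // v Wv.
  by rewrite -[g j v]sqi; apply: Wi; exact: (complex_act_stable Wrho).
- exact: sqi.
- case=> a b v; rewrite !complex_actE /= (operD (g i)) !(operZ (g i)).
  by rewrite !(ji, sqi, operN (g i)) scaleNr scalerN opprK.
Qed.

(** The even products are generated by J1 = g_i g_j and J2 = g_i g_k, which act
    as the quaternions i and j; tau = g_i is an involution. *)
Lemma even_commutant_0_3 : even_commutant 0 3 (quat R).
Proof.
move=> V A s g cp cq sys; have [t [ut st At tA]] := positive_enum cp cq.
case: t ut st At tA => [|i [|j [|k []]]] //.
rewrite /= !inE andbT negb_or -andbA => /and3P[ij ik jk] _ At tA.
have [iA si] : i \in A /\ s i = false by apply: At; rewrite !inE eqxx.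
have [jA sj] : j \in A /\ s j = false by apply: At; rewrite !inE eqxx orbT.
have [kA sk] : k \in A /\ s k = false by apply: At; rewrite !inE eqxx !orbT.
have sqi v : g i (g i v) = v by rewrite (system_sqr sys) // si scale1r.
have sqj v : g j (g j v) = v by rewrite (system_sqr sys) // sj scale1r.
have sqk v : g k (g k v) = v by rewrite (system_sqr sys) // sk scale1r.
have ji v : g j (g i v) = - g i (g j v) by rewrite (system_anti sys) // eq_sym.
have ki v : g k (g i v) = - g i (g k v) by rewrite (system_anti sys) // eq_sym.
have kj v : g k (g j v) = - g j (g k v) by rewrite (system_anti sys) // eq_sym.
(* These rules sort a product of generators and cancel squares. *)
have simp := (sqi, sqj, sqk, ji, ki, kj,
  operN (g i), operN (g j), operN (g k), @opprK V).
pose J1 : {linear V -> V} := g i \o g j.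
pose J2 : {linear V -> V} := g i \o g k.
have J1K v : J1 (J1 v) = - v by rewrite /= !simp.
have J2K v : J2 (J2 v) = - v by rewrite /= !simp.
have J21 v : J2 (J1 v) = - J1 (J2 v) by rewrite /= !simp.
have [qK ql qM] := quat_involution R.
apply: (@realizes_ext _ _ (rho_comm (quat_act J1 J2))).
  move=> h hl; rewrite quat_act_comm //; split=> [[H1 H2]|H]; last first.
    by split=> v; apply: H.
  apply: (even_comm_pivot sys hl iA) => l /tA.
  rewrite !inE => /or3P[]/eqP -> => [|_ v|_ v]; first by rewrite eqxx.
    by rewrite !ji (linear_funN hl) H1.
  by rewrite !ki (linear_funN hl) H2.
pose sigma (x : quat R) := let: Quat a b c d := x in Quat a (- b) (- c) d.
apply: (rank_one_commutant (quat_actP J1K J2K J21) qK ql qM (@quat_div R)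
  (tau := g i) (system_neq0 sys) (sigma := sigma)).
- move=> W WP /quat_act_stable[W1 W2] Wi _; apply: (system_irr sys WP) => l /tA.
  rewrite !inE => /or3P[]/eqP -> // v Wv.
    by rewrite -[g j v]sqi; apply: Wi; exact: W1.
  by rewrite -[g k v]sqi; apply: Wi; exact: W2.
- exact: sqi.
- case=> a b c d v; rewrite !quat_actE /= !(operD (g i)) !(operZ (g i)) !simp.
  by rewrite !scaleNr !scalerN !opprK.
Qed.

Section NegativeDefiniteTriple.
Variables (V : lmodType R) (A : {set I}) (s : I -> bool).
Variable g : I -> {linear V -> V}.
Hypothesis sys : clifford_system A s g.
Variables (i j k : I).
Hypotheses (iA : i \in A) (jA : j \in A) (kA : k \in A).
Hypotheses (si : s i) (sj : s j) (sk : s k).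
Hypotheses (ij : i != j) (ik : i != k) (jk : j != k).

Let sqi v : g i (g i v) = - v.
Proof. by rewrite (system_sqr sys) // si scaleN1r. Qed.
Let sqj v : g j (g j v) = - v.
Proof. by rewrite (system_sqr sys) // sj scaleN1r. Qed.
Let sqk v : g k (g k v) = - v.
Proof. by rewrite (system_sqr sys) // sk scaleN1r. Qed.
Let ji v : g j (g i v) = - g i (g j v).
Proof. by rewrite (system_anti sys) // eq_sym. Qed.
Let ki v : g k (g i v) = - g i (g k v).
Proof. by rewrite (system_anti sys) // eq_sym. Qed.
Let kj v : g k (g j v) = - g j (g k v).
Proof. by rewrite (system_anti sys) // eq_sym. Qed.
Let simp := (sqi, sqj, sqk, ji, ki, kj,
  operN (g i), operN (g j), operN (g k), @opprK V).

Definition quat_unit1 : {linear V -> V} := g i \o g j.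
Definition quat_unit2 : {linear V -> V} := g i \o g k.
(** The product of three generators; with all squares equal to -1, it is an
    involution commuting with the three of them. *)
Definition volume3 : {linear V -> V} := g i \o g j \o g k.
Local Notation J1 := quat_unit1.
Local Notation J2 := quat_unit2.
Local Notation rho := (quat_act J1 J2).

Lemma triple_actP : is_action rho.
Proof. by apply: quat_actP => v; rewrite /= !simp. Qed.

Lemma volume3K v : volume3 (volume3 v) = v.
Proof. by rewrite /= !simp. Qed.

Lemma volume3_act d v : volume3 (rho d v) = rho d (volume3 v).
Proof.
apply: ((quat_act_comm _ _ _).2 _ d v); first by move=> a x y; rewrite linearP.
by split=> u; rewrite /= !simp.
Qed.

Lemma triple_stable (W : V -> Prop) : subspace W ->
  (forall d v, W v -> W (rho d v)) -> (forall v, W v -> W (volume3 v)) ->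
  forall l, l \in [:: i; j; k] -> forall v, W v -> W (g l v).
Proof.
move=> WP /quat_act_stable[W1 W2] Wvol.
have Wi v : W v -> W (g i v).
  move=> /Wvol/W2/W1 /(subspaceN WP).
  by rewrite (_ : - _ = g i v) // /= !simp.
move=> l; rewrite !inE => /or3P[]/eqP -> v Wv.
- exact: Wi.
- by move: (subspaceN WP (Wi _ (W1 _ Wv))); rewrite /= !simp.
- by move: (subspaceN WP (Wi _ (W2 _ Wv))); rewrite /= !simp.
Qed.

End NegativeDefiniteTriple.

(** The generators are products of [volume3] and of even products, so that V is
    irreducible under the quaternions and the involution [volume3]. *)
Lemma even_commutant_3_0 : even_commutant 3 0 (quat R).
Proof.
move=> V A s g cp cq sys; have [t [ut st At tA]] := negative_enum cp cq.
case: t ut st At tA => [|i [|j [|k []]]] //.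
rewrite /= !inE andbT negb_or -andbA => /and3P[ij ik jk] _ At tA.
have [iA si] : i \in A /\ s i by apply: At; rewrite !inE eqxx.
have [jA sj] : j \in A /\ s j by apply: At; rewrite !inE eqxx orbT.
have [kA sk] : k \in A /\ s k by apply: At; rewrite !inE eqxx !orbT.
have ji v : g j (g i v) = - g i (g j v) by rewrite (system_anti sys) // eq_sym.
have ki v : g k (g i v) = - g i (g k v) by rewrite (system_anti sys) // eq_sym.
have [qK ql qM] := quat_involution R.
pose J1 := quat_unit1 g i j; pose J2 := quat_unit2 g i k.
apply: (@realizes_ext _ _ (rho_comm (quat_act J1 J2))).
  move=> h hl; rewrite quat_act_comm //; split=> [[H1 H2]|H]; last first.
    by split=> v; apply: H.
  apply: (even_comm_pivot sys hl iA) => l /tA.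
  rewrite !inE => /or3P[]/eqP -> => [|_ v|_ v]; first by rewrite eqxx.
    by rewrite !ji (linear_funN hl) H1.
  by rewrite !ki (linear_funN hl) H2.
have rhoP := triple_actP sys iA jA kA si sj sk ij ik jk.
apply: (rank_one_commutant rhoP qK ql qM (@quat_div R) (tau := volume3 g i j k)
  (system_neq0 sys) (sigma := id)).
- move=> W WP Wrho Wvol _; apply: (system_irr sys WP) => l /tA.
  exact: (triple_stable sys iA jA kA si sj sk ij ik jk WP Wrho Wvol).
- exact: (volume3K sys iA jA kA si sj sk ij ik jk).
- exact: (volume3_act sys iA jA kA si sj sk ij ik jk).
Qed.

(** The even products are generated by the quaternions of the first three
    generators and by the product omega of the four generators. *)
Lemma even_commutant_4_0 : even_commutant 4 0 (quat R * quat R)%type.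
Proof.
move=> V A s g cp cq sys; have [t [ut st At tA]] := negative_enum cp cq.
case: t ut st At tA => [|i [|j [|k [|l []]]]] //.
rewrite /= !inE andbT !negb_or -!andbA => /and5P[].
move=> ij ik il jk /andP[jl kl] _ At tA.
have [iA si] : i \in A /\ s i by apply: At; rewrite !inE eqxx.
have [jA sj] : j \in A /\ s j by apply: At; rewrite !inE eqxx orbT.
have [kA sk] : k \in A /\ s k by apply: At; rewrite !inE eqxx !orbT.
have [lA sl] : l \in A /\ s l by apply: At; rewrite !inE eqxx !orbT.
have sqi v : g i (g i v) = - v by rewrite (system_sqr sys) // si scaleN1r.
have sqj v : g j (g j v) = - v by rewrite (system_sqr sys) // sj scaleN1r.
have sqk v : g k (g k v) = - v by rewrite (system_sqr sys) // sk scaleN1r.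
have sql v : g l (g l v) = - v by rewrite (system_sqr sys) // sl scaleN1r.
have ji v : g j (g i v) = - g i (g j v) by rewrite (system_anti sys) // eq_sym.
have ki v : g k (g i v) = - g i (g k v) by rewrite (system_anti sys) // eq_sym.
have kj v : g k (g j v) = - g j (g k v) by rewrite (system_anti sys) // eq_sym.
have li v : g l (g i v) = - g i (g l v) by rewrite (system_anti sys) // eq_sym.
have lj v : g l (g j v) = - g j (g l v) by rewrite (system_anti sys) // eq_sym.
have lk v : g l (g k v) = - g k (g l v) by rewrite (system_anti sys) // eq_sym.
have simp := (sqi, sqj, sqk, sql, ji, ki, kj, li, lj, lk,
  operN (g i), operN (g j), operN (g k), operN (g l), @opprK V).
have [qK ql qM] := quat_involution R.
pose J1 := quat_unit1 g i j; pose J2 := quat_unit2 g i k.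
pose omega : {linear V -> V} := volume3 g i j k \o g l.
apply: (@realizes_ext _ _
    (fun h => rho_comm (quat_act J1 J2) h /\
      forall v, h (omega v) = omega (h v))).
  move=> h hl; rewrite quat_act_comm //; split=> [[[H1 H2] H3]|H]; last first.
    split; first by split=> v; apply: H.
    by move=> v; rewrite /= !H.
  apply: (even_comm_pivot sys hl iA) => m /tA.
  rewrite !inE => /or4P[]/eqP -> => [|_ v|_ v|_ v]; first by rewrite eqxx.
  - by rewrite !ji (linear_funN hl) H1.
  - by rewrite !ki (linear_funN hl) H2.
  - have E u : g l (g i u) = J1 (J2 (omega u)) by rewrite /= !simp.
    by rewrite !E H1 H2 H3.
have rhoP := triple_actP sys iA jA kA si sj sk ij ik jk.
apply: (rank_two_diag_commutant rhoP qK ql qM (@quat_div R) (tau := g l)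
  (system_neq0 sys) (omega := omega) (c := -1)).
- move=> W WP Wrho Wl Womega; apply: (system_irr sys WP) => m /tA.
  rewrite !inE !orbA => /orP[mt|/eqP -> //].
  apply: (triple_stable sys iA jA kA si sj sk ij ik jk WP Wrho) => [|].
    by move=> v Wv; move: (subspaceN WP (Womega _ (Wl _ Wv))); rewrite /= !simp.
  by rewrite !inE orbA.
- by move=> v; rewrite /= !simp.
- by rewrite oppr_eq0 oner_eq0.
- by move=> v; rewrite /= !simp scaleN1r.
- by move=> v; rewrite /= !simp.
- move=> d v; apply: ((quat_act_comm _ _ _).2 _ d v).
    by move=> a x y; rewrite linearP.
  by split=> u; rewrite /= !simp.
- move=> d v; apply: ((quat_act_comm _ _ _).2 _ d v).
    by move=> a x y; rewrite linearP.
  by split=> u; rewrite /= !simp.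
Qed.

Lemma even_commutant_1_1 : even_commutant 1 1 (R^o * R^o)%type.
Proof.
move=> V A s g cp cq sys.
have [t [_ st] At] := set_enum_card cp; case: t st At => [|i []] // _ At.
have [t [_ st] Au] := set_enum_card cq; case: t st Au => [|j []] // _ Au.
have /andP[iA si] : (i \in A) && s i by have := At i; rewrite !inE eqxx.
have /andP[jA sj] : (j \in A) && ~~ s j by have := Au j; rewrite !inE eqxx.
have ij : i != j by apply: contraNneq sj => <-.
have tA k : k \in A -> k = i \/ k = j.
  move=> kA; have := At k; have := Au k; rewrite !inE kA /=.
  by case: (s k) => /= E1 E2; [left|right]; apply/eqP; rewrite -?E1 -?E2.
have sqi v : g i (g i v) = - v by rewrite (system_sqr sys) // si scaleN1r.
have sqj v : g j (g j v) = v by rewrite (system_sqr sys) // (negPf sj) scale1r.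
have ji v : g j (g i v) = - g i (g j v) by rewrite (system_anti sys) // eq_sym.
have simp := (sqi, sqj, ji, operN (g i), operN (g j), @opprK V).
have [rK rl rM] := real_involution R.
pose omega : {linear V -> V} := g i \o g j.
apply: (@realizes_ext _ _
    (fun h => rho_comm (@real_act R V) h /\
      forall v, h (omega v) = omega (h v))).
  move=> h hl; split=> [[_ H]|H].
    apply: (even_comm_pivot sys hl jA) => k /tA[] ->; last by rewrite eqxx.
    by move=> _; exact: H.
  by split=> [|v]; [exact: real_act_comm|exact: H].
apply: (rank_two_diag_commutant (real_actP V) rK rl rM (@real_div R)
  (tau := g i) (system_neq0 sys) (omega := omega) (c := -1)).
- move=> W WP _ Wi Womega; apply: (system_irr sys WP) => k /tA[] -> // v Wv.
  by move: (subspaceN WP (Wi _ (Womega _ Wv))); rewrite /= !simp.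
- by move=> v; rewrite /= !simp.
- by rewrite oppr_eq0 oner_eq0.
- by move=> v; rewrite /= !simp scaleN1r.
- by move=> v; rewrite /= !simp.
- by move=> d v; rewrite /= !operZ.
- by move=> d v; rewrite /= !operZ.
Qed.

End CliffordSystems.

(** * Changing the sign of four squares *)

Section Flip.
Variables (R : realType) (I : finType).

Section FlipSystem.
Variables (V : lmodType R) (A : {set I}) (s : I -> bool).
Variable g : I -> {linear V -> V}.
Hypothesis sys : clifford_system A s g.
Variables (i j k l : I) (e : bool).
Let t := [:: i; j; k; l].
Hypothesis ut : uniq t.
Hypothesis tA : {in t, forall x, x \in A /\ s x = e}.

(** The product of four generators with the same square: an involution
    anticommuting with them and commuting with the other generators. *)
Definition volume4 : {linear V -> V} := g i \o g j \o g k \o g l.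
Definition flip_sign x := if x \in t then ~~ s x else s x.
(** The new generators: the four chosen ones, multiplied by [volume4], and the
    others unchanged. *)
Definition flip_gen x : {linear V -> V} :=
  if x \in t then (g x \o volume4 : {linear V -> V}) else g x.
Local Notation eta := volume4.

Let iA : i \in A. Proof. by apply: (tA _).1; rewrite !inE eqxx. Qed.
Let jA : j \in A. Proof. by apply: (tA _).1; rewrite !inE eqxx ?orbT. Qed.
Let kA : k \in A. Proof. by apply: (tA _).1; rewrite !inE eqxx ?orbT. Qed.
Let lA : l \in A. Proof. by apply: (tA _).1; rewrite !inE eqxx ?orbT. Qed.

Let sq x v : x \in t -> g x (g x v) = if e then - v else v.
Proof.
move=> xt; have [xA sx] := tA xt; rewrite (system_sqr sys) // sx.
by case: (e); rewrite ?scaleN1r ?scale1r.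
Qed.

Let sqi v : g i (g i v) = if e then - v else v.
Proof. by apply: sq; rewrite !inE eqxx. Qed.
Let sqj v : g j (g j v) = if e then - v else v.
Proof. by apply: sq; rewrite !inE eqxx ?orbT. Qed.
Let sqk v : g k (g k v) = if e then - v else v.
Proof. by apply: sq; rewrite !inE eqxx ?orbT. Qed.
Let sql v : g l (g l v) = if e then - v else v.
Proof. by apply: sq; rewrite !inE eqxx ?orbT. Qed.

Let anti x y v : x \in A -> y \in A -> y != x -> g x (g y v) = - g y (g x v).
Proof. by move=> xA yA yx; rewrite (system_anti sys) // eq_sym. Qed.

Let distinct : [/\ [/\ i != j, i != k & i != l], j != k, j != l & k != l].
Proof.
move: ut; rewrite /= !inE andbT !negb_or -!andbA.
by case/and5P=> -> -> -> -> /andP[-> ->].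
Qed.

Let ji v : g j (g i v) = - g i (g j v).
Proof. by case: distinct => -[*]; apply: anti. Qed.
Let ki v : g k (g i v) = - g i (g k v).
Proof. by case: distinct => -[*]; apply: anti. Qed.
Let li v : g l (g i v) = - g i (g l v).
Proof. by case: distinct => -[*]; apply: anti. Qed.
Let kj v : g k (g j v) = - g j (g k v).
Proof. by case: distinct => -[*]; apply: anti. Qed.
Let lj v : g l (g j v) = - g j (g l v).
Proof. by case: distinct => -[*]; apply: anti. Qed.
Let lk v : g l (g k v) = - g k (g l v).
Proof. by case: distinct => -[*]; apply: anti. Qed.
Let simp := (sqi, sqj, sqk, sql, ji, ki, kj, li, lj, lk,
  operN (g i), operN (g j), operN (g k), operN (g l), @opprK V).

Lemma volume4K v : eta (eta v) = v.
Proof. by rewrite /=; move: simp; case: (e) => sm; rewrite !sm. Qed.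

Lemma volume4_in x v : x \in t -> eta (g x v) = - g x (eta v).
Proof.
by rewrite !inE => /or4P[]/eqP -> /=; move: simp; case: (e) => sm; rewrite !sm.
Qed.

Lemma volume4_out x v : x \in A -> x \notin t -> eta (g x v) = g x (eta v).
Proof.
move=> xA; rewrite !inE !negb_or => /and4P[xi xj xk xl].
have xanti y u : y \in A -> x != y -> g y (g x u) = - g x (g y u).
  by move=> *; apply: anti.
rewrite /= (xanti l) // (operN (g k)) (xanti k) // opprK.
by rewrite (xanti j) // (operN (g i)) (xanti i) // opprK.
Qed.

Lemma flip_in x v : x \in t -> flip_gen x v = g x (eta v).
Proof. by rewrite /flip_gen => ->. Qed.
Lemma flip_out x v : x \notin t -> flip_gen x v = g x v.
Proof. by rewrite /flip_gen => /negPf ->. Qed.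

Lemma flip_volume4 v :
  eta v = flip_gen i (flip_gen j (flip_gen k (flip_gen l v))).
Proof.
rewrite !flip_in ?inE ?eqxx ?orbT //.
have itm x u : x \in t -> eta (g x u) = - g x (eta u) by apply: volume4_in.
rewrite (itm j) ?inE ?eqxx ?orbT // (itm l) ?inE ?eqxx ?orbT // !volume4K.
by rewrite !simp.
Qed.

(** Up to sign and a factor [volume4], the product of two new generators is the
    product of the old ones. *)
Lemma flip_pair x y : x \in A -> y \in A -> exists (c : R) (m : bool), forall v,
  flip_gen x (flip_gen y v) = c *: g x (g y (if m then eta v else v)) /\
  g x (g y v) = c *: flip_gen x (flip_gen y (if m then eta v else v)).
Proof.
move=> xA yA; have [xt|xt] := boolP (x \in t); have [yt|yt] := boolP (y \in t).
- exists (-1), false => v.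
  rewrite !flip_in // (volume4_in _ yt) volume4K !scaleN1r.
  by rewrite (operN (g x)) opprK.
- exists 1, true => v; rewrite !(flip_in _ xt) !(flip_out _ yt) !scale1r.
  by rewrite !(volume4_out _ yA yt) volume4K.
- exists 1, true => v; rewrite !(flip_in _ yt) !(flip_out _ xt) !scale1r.
  by rewrite volume4K.
- by exists 1, false => v; rewrite !flip_out // scale1r.
Qed.

Lemma flip_system : clifford_system A flip_sign flip_gen.
Proof.
split=> [x xA v|x y xA yA xy v||W WP Wg].
- rewrite /flip_sign; case: ifP => xt; last first.
    by rewrite !flip_out ?xt // (system_sqr sys).
  rewrite !flip_in // (volume4_in _ xt) volume4K (operN (g x)).
  rewrite (system_sqr sys) //.
  by rewrite -scaleNr; case: (s x); rewrite ?opprK.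
- have [xt|xt] := boolP (x \in t); have [yt|yt] := boolP (y \in t).
  + rewrite !flip_in // (volume4_in _ xt) (volume4_in _ yt) !volume4K.
    rewrite (operN (g x)) (operN (g y)) opprK.
    by rewrite (system_anti sys) ?opprK.
  + rewrite !(flip_in _ xt) !(flip_out _ yt) volume4_out //.
    by rewrite (system_anti sys).
  + rewrite !(flip_in _ yt) !(flip_out _ xt) volume4_out //.
    by rewrite (system_anti sys).
  + by rewrite !flip_out // (system_anti sys).
- exact: system_neq0 sys.
- apply: (system_irr sys WP) => x xA v Wv.
  have [xt|xt] := boolP (x \in t); last by rewrite -flip_out //; apply: Wg.
  rewrite -[v]volume4K -flip_in //; apply: (Wg) => //.
  by rewrite flip_volume4; do 4![apply: (Wg) => //].
Qed.

Lemma flip_even_comm h : linear h -> even_comm A flip_gen h <-> even_comm A g h.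
Proof.
move=> hl; split=> H x y xA yA v; have [c [m E]] := flip_pair xA yA.
  have heta u : h (eta u) = eta (h u) by rewrite !flip_volume4 !H.
  by rewrite !(E _).2 (linear_funZ hl) H //; case: m {E}; rewrite ?heta.
have heta u : h (eta u) = eta (h u) by rewrite /= !H.
by rewrite !(E _).1 (linear_funZ hl) H //; case: m {E}; rewrite ?heta.
Qed.

End FlipSystem.

Lemma card_flip (A : {set I}) (P : pred I) (t : seq I) (f : I -> bool) n m :
  uniq t -> size t = n -> {in t, forall x, x \in A /\ P x} ->
  (forall x, f x = if x \in t then false else P x) ->
  #|[set x in A | P x]| = m + n -> #|[set x in A | f x]| = m.
Proof.
move=> ut st tA fE cm; have ct : #|[set x in t]| = n.
  by rewrite cardsE (card_uniqP ut).
have -> : [set x in A | f x] = [set x in A | P x] :\: [set x in t].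
  by apply/setP => x; rewrite !inE fE; case: (x \in t); rewrite ?andbF.
rewrite cardsD (setIidPr _) ?cm ?ct ?addnK //.
by apply/subsetP => x; rewrite !inE => /tA[-> ->].
Qed.

Lemma card_flipC (A : {set I}) (P : pred I) (t : seq I) (f : I -> bool) n m :
  uniq t -> size t = n -> {in t, forall x, x \in A /\ P x = false} ->
  (forall x, f x = if x \in t then true else P x) ->
  #|[set x in A | P x]| = m -> #|[set x in A | f x]| = m + n.
Proof.
move=> ut st tA fE cm; have ct : #|[set x in t]| = n.
  by rewrite cardsE (card_uniqP ut).
have -> : [set x in A | f x] = [set x in A | P x] :|: [set x in t].
  apply/setP => x; rewrite !inE fE; case: ifP => [/tA[-> ->]|] //.
  by rewrite orbF.
rewrite cardsU cm ct (_ : _ :&: _ = set0) ?cards0 ?subn0 //.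
apply/setP => x; rewrite !inE; apply/negP => /andP[/andP[_ Px] /tA[_]].
by rewrite Px.
Qed.

Lemma even_commutant_flipl p q (B : algType R) :
  even_commutant I p (q + 4) B -> even_commutant I (p + 4) q B.
Proof.
move=> H V A s g cp cq sys.
have /card_geqP[t [ut st tS]] : (4 <= #|[set i in A | s i]|)%N.
  by rewrite cp leq_addl.
have tA : {in t, forall x, x \in A /\ s x = true}.
  by move=> x /tS; rewrite !inE => /andP[].
case: t ut st {tS} tA => [|i [|j [|k [|l []]]]] // ut st tA.
apply: (realizes_ext (flip_even_comm sys ut tA)).
apply: H (flip_system sys ut tA).
  apply: (card_flip ut st tA _ cp) => x.
  by rewrite /flip_sign; case: ifP => // /tA[_ ->].
apply: (card_flipC ut st _ _ cq) => [x /tA[-> ->] //|x].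
by rewrite /flip_sign; case: ifP => // /tA[_ ->].
Qed.

Lemma even_commutant_flipr p q (B : algType R) :
  even_commutant I (p + 4) q B -> even_commutant I p (q + 4) B.
Proof.
move=> H V A s g cp cq sys.
have /card_geqP[t [ut st tS]] : (4 <= #|[set i in A | ~~ s i]|)%N.
  by rewrite cq leq_addl.
have tA : {in t, forall x, x \in A /\ s x = false}.
  by move=> x /tS; rewrite !inE => /andP[-> /negPf].
case: t ut st {tS} tA => [|i [|j [|k [|l []]]]] // ut st tA.
apply: (realizes_ext (flip_even_comm sys ut tA)).
apply: H (flip_system sys ut tA).
  apply: (card_flipC ut st tA _ cp) => x.
  by rewrite /flip_sign; case: ifP => // /tA[_ ->].
apply: (card_flip ut st _ _ cq) => [x /tA[-> ->] //|x].
by rewrite /flip_sign; case: ifP => // /tA[_ ->].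
Qed.

End Flip.

(** * Removing a pair of operators with opposite squares *)

Section FixedSpace.
Variables (R : realType) (V : lmodType R) (w : {linear V -> V}).

Definition fixed_pred : {pred V} := fun v => w v == v.

Lemma fixed_pred_submod : submod_closed fixed_pred.
Proof.
split=> [|a u v]; rewrite !unfold_in ?oper0 // => /eqP wu /eqP wv.
by rewrite operD operZ wu wv.
Qed.

HB.instance Definition _ :=
  GRing.isSubmodClosed.Build R V fixed_pred fixed_pred_submod.

(** The subspace of the vectors fixed by w, as a real vector space. *)
Record fixed := Fixed { fixed_val : V; _ : fixed_val \in fixed_pred }.

HB.instance Definition _ := [isSub for fixed_val].
HB.instance Definition _ := [Choice of fixed by <:].
HB.instance Definition _ := [SubChoice_isSubLmodule of fixed by <:].

Lemma fixedP (x : fixed) : w (val x) = val x.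
Proof. exact/eqP/(valP x). Qed.

Lemma fixed_valP : linear (val : fixed -> V).
Proof. by move=> a x y; rewrite linearP. Qed.

Lemma fixed_val0 : val (0 : fixed) = 0.
Proof. exact: linear_fun0 fixed_valP. Qed.
Lemma fixed_valN (x : fixed) : val (- x) = - val x.
Proof. exact: linear_funN fixed_valP x. Qed.
Lemma fixed_valZ a (x : fixed) : val (a *: x) = a *: val x.
Proof. exact: linear_funZ fixed_valP a x. Qed.

Hypothesis wK : forall v, w (w v) = v.

Lemma fixed_proj_subproof v : 2^-1 *: (v + w v) \in fixed_pred.
Proof. by rewrite unfold_in (operZ w) (operD w) wK addrC. Qed.

(** The projection along the eigenspace of the involution w for -1. *)
Definition fixed_proj v : fixed := Fixed (fixed_proj_subproof v).

Lemma fixed_proj_linear : linear fixed_proj.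
Proof.
move=> a u v; apply: val_inj; rewrite fixed_valP /=.
rewrite (operD w) (operZ w) addrACA -[a *: u + _]scalerDr [LHS]scalerDr.
by rewrite !scalerA mulrC.
Qed.

HB.instance Definition _ :=
  GRing.isLinear.Build R V fixed _ fixed_proj fixed_proj_linear.

Lemma fixed_proj0 : fixed_proj 0 = 0.
Proof. exact: linear_fun0 fixed_proj_linear. Qed.
Lemma fixed_projD u v : fixed_proj (u + v) = fixed_proj u + fixed_proj v.
Proof. exact: linear_funD fixed_proj_linear u v. Qed.
Lemma fixed_projN v : fixed_proj (- v) = - fixed_proj v.
Proof. exact: linear_funN fixed_proj_linear v. Qed.
Lemma fixed_projZ a v : fixed_proj (a *: v) = a *: fixed_proj v.
Proof. exact: linear_funZ fixed_proj_linear a v. Qed.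

Lemma fixed_valK x : fixed_proj (val x) = x.
Proof.
apply: val_inj; rewrite /= fixedP -mulr2n -scaler_nat scalerA mulVf ?scale1r //.
by rewrite pnatr_eq0.
Qed.

Lemma fixed_projE v : val (fixed_proj v) = 2^-1 *: (v + w v).
Proof. by []. Qed.

Lemma fixed_proj_anti v : w v = - v -> fixed_proj v = 0.
Proof.
by move=> wv; apply: val_inj; rewrite fixed_projE wv subrr scaler0 linear0.
Qed.

(** The restriction of f to the fixed space, when f commutes with w; in general,
    its compression. *)
Definition fixed_restr (f : {linear V -> V}) : {linear fixed -> fixed} :=
  fixed_proj \o (f \o (val : fixed -> V)).

Lemma fixed_restrE (f : {linear V -> V}) x :
  (forall u, w (f u) = f (w u)) -> val (fixed_restr f x) = f (val x).
Proof.
move=> wf; rewrite /= wf -[w (fixed_val x)]/(w (val x)) fixedP -mulr2n.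
rewrite -scaler_nat scalerA mulVf ?scale1r //.
by rewrite pnatr_eq0.
Qed.

Lemma fixed_proj_restr (f : {linear V -> V}) v :
  (forall u, w (f u) = f (w u)) ->
  fixed_proj (f v) = fixed_restr f (fixed_proj v).
Proof.
move=> wf; apply: val_inj.
by rewrite fixed_restrE // !fixed_projE wf (operZ f) (operD f).
Qed.

End FixedSpace.

Section HyperbolicStep.
Variables (R : realType) (I : finType) (V : lmodType R).
Variables (A : {set I}) (s : I -> bool) (g : I -> {linear V -> V}).
Hypothesis sys : clifford_system A s g.
Variables (i j : I).
Hypotheses (iA : i \in A) (jA : j \in A) (si : s i) (sj : s j = false).

Let A' := A :\ i :\ j.
Let ij : i != j. Proof. by apply: contraTneq si => ->; rewrite sj. Qed.
Let sqi v : g i (g i v) = - v.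
Proof. by rewrite (system_sqr sys) // si scaleN1r. Qed.
Let sqj v : g j (g j v) = v.
Proof. by rewrite (system_sqr sys) // sj scale1r. Qed.
Let ji v : g j (g i v) = - g i (g j v).
Proof. by rewrite (system_anti sys) // eq_sym. Qed.

Let A'P x : x \in A' -> [/\ x \in A, x != i & x != j].
Proof. by rewrite !inE => /and3P[]. Qed.

(** The involution g_i g_j, where g_i has square -1 and g_j has square 1. *)
Definition hyperbolic_inv : {linear V -> V} := g i \o g j.
Local Notation w := hyperbolic_inv.

Lemma hyperbolic_invK v : w (w v) = v.
Proof. by rewrite /= ji sqj (operN (g i)) sqi opprK. Qed.

Let wi v : w (g i v) = - g i (w v).
Proof. by rewrite /= ji (operN (g i)). Qed.
Let gjE v : g j v = - g i (w v).
Proof. by rewrite /= sqi opprK. Qed.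
Let wg x v : x \in A' -> w (g x v) = g x (w v).
Proof.
move=> /A'P[xA xi xj]; rewrite /= (system_anti sys jA xA) 1?eq_sym //.
by rewrite (operN (g i)) (system_anti sys iA xA) 1?eq_sym // opprK.
Qed.

Local Notation V' := (fixed w).
Local Notation P := (fixed_proj hyperbolic_invK).
Definition hyperbolic_gen x : {linear V' -> V'} :=
  fixed_restr hyperbolic_invK (g x).
Local Notation g' := hyperbolic_gen.

Let valg x y : x \in A' -> val (g' x y) = g x (val y).
Proof. by move=> xA; apply: fixed_restrE => u; apply: wg. Qed.
Let Pg x v : x \in A' -> P (g x v) = g' x (P v).
Proof. by move=> xA; apply: fixed_proj_restr => u; apply: wg. Qed.
Let Pw v : P (w v) = P v.
Proof. by apply: val_inj; rewrite !fixed_projE hyperbolic_invK addrC. Qed.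
Let Pi (y : V') : P (g i (val y)) = 0.
Proof. by apply: fixed_proj_anti; rewrite wi fixedP. Qed.

Lemma hyperbolic_system : clifford_system A' s g'.
Proof.
split=> [x xA y|x y xA yA xy v||W WP Wg].
- apply: val_inj; rewrite !valg // (system_sqr sys); last by case: (A'P xA).
  by rewrite fixed_valZ.
- apply: val_inj; rewrite fixed_valN !valg //.
  by rewrite (system_anti sys) //; [case: (A'P xA)|case: (A'P yA)].
- (* If w is -1 on v, it is 1 on g_i v, as it anticommutes with g_i. *)
  have [v v0] := system_neq0 sys.
  have [E|E] := eqVneq (P v) 0; last by exists (P v).
  exists (P (g i v)); apply: contra_neq v0 => E'.
  have wv u : P u = 0 -> w u = - u.
    move=> /(congr1 val); rewrite fixed_projE fixed_val0.
    move/eqP; rewrite scaler_eq0 invr_eq0 pnatr_eq0 /= addrC addr_eq0.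
    by move/eqP.
  have := wi v; rewrite (wv _ E') (wv _ E) (operN (g i)) opprK.
  move/eqP; rewrite eq_sym -addr_eq0 -mulr2n -scaler_nat scaler_eq0.
  rewrite pnatr_eq0 /= => /eqP gv.
  by apply/eqP; rewrite -oppr_eq0 -sqi gv oper0.
- (* W' is W + g_i W, the stable subspace generated by W. *)
  pose W' v := W (P v) /\ W (P (g i v)).
  have [||H|H] := system_irr sys (W := W').
  + split=> [|a u v [Wu Wiu] [Wv Wiv]].
      by split; rewrite ?oper0 fixed_proj0; case: WP.
    split; rewrite ?(operD (g i)) ?(operZ (g i)) fixed_proj_linear; exact: WP.2.
  + move=> x xA v [Wv Wiv].
    have Wgi : W' (g i v).
      split=> //; rewrite sqi fixed_projN.
      exact: subspaceN.
    have [->//|xi] := eqVneq x i; have [->|xj] := eqVneq x j.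
      split.
        rewrite gjE -[_ (w v)]opprK -wi opprK Pw; exact: Wiv.
      by rewrite -[g i (g j v)]/(w v) Pw.
    have xA' : x \in A' by rewrite !inE xi xj.
    split; first by rewrite Pg //; apply: Wg.
    rewrite (system_anti sys) 1?eq_sym // fixed_projN Pg //.
    by apply: subspaceN => //; apply: Wg.
  + left=> y Wy; apply: val_inj; rewrite fixed_val0.
    by apply: H; split; rewrite ?fixed_valK // Pi; case: WP.
  + by right=> y; have [] := H (val y); rewrite fixed_valK.
Qed.

Variable k : I.
Hypothesis kA' : k \in A'.

Let kA : k \in A. Proof. by case: (A'P kA'). Qed.
Let ki : k != i. Proof. by case: (A'P kA'). Qed.
Let kj : k != j. Proof. by case: (A'P kA'). Qed.
Let c : R := (-1) ^+ s k.
Let cK v : c *: (c *: v) = v :> V.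
Proof. by rewrite scalerA -expr2 sqrr_sign scale1r. Qed.

(* u exchanges the two eigenspaces of w, and its inverse is c u. *)
Let u : {linear V -> V} := g k \o g i.
Let uK v : u (u v) = c *: v.
Proof.
rewrite /= (system_anti sys iA kA) 1?eq_sym // sqi !(operN (g k)) opprK.
by rewrite (system_sqr sys).
Qed.
Let wu v : w (u v) = - u (w v).
Proof.
by rewrite /u [in LHS]/= -[g i (g j _)]/(w _) wg // wi (operN (g k)).
Qed.
Let Pu (y : V') : P (u (val y)) = 0.
Proof. by apply: fixed_proj_anti; rewrite wu fixedP. Qed.

Let split_fixed v : v = val (P v) + c *: u (val (P (u v))).
Proof.
have -> : u (val (P (u v))) = c *: (2^-1 *: (v - w v)).
  rewrite fixed_projE wu (operZ u) (operD u) (operN u) !uK -scalerBr.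
  by rewrite !scalerA mulrC.
rewrite cK fixed_projE -scalerDr addrACA subrr addr0 -mulr2n -scaler_nat.
by rewrite scalerA mulVf ?scale1r // pnatr_eq0.
Qed.

(** The map that is h on the fixed space of w and the conjugate of h by u on the
    other eigenspace. *)
Definition hyperbolic_lift (h : V' -> V') (v : V) : V :=
  val (h (P v)) + c *: u (val (h (P (u v)))).
Local Notation lift := hyperbolic_lift.

Let lift_P h v : P (lift h v) = h (P v).
Proof.
rewrite /lift fixed_projD fixed_valK.
by rewrite fixed_projZ Pu scaler0 addr0.
Qed.

Let lift_Pu h v : P (u (lift h v)) = h (P (u v)).
Proof.
rewrite /lift (operD u) (operZ u) uK cK.
by rewrite fixed_projD fixed_valK Pu add0r.
Qed.

Lemma hyperbolic_lift_linear h : linear h -> linear (lift h).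
Proof.
move=> hl a x y.
rewrite /lift (operD u) (operZ u) !fixed_proj_linear !hl !fixed_valP.
rewrite (operD u) (operZ u) !scalerDr addrACA; congr (_ + _ + _).
by rewrite !scalerA mulrC.
Qed.

Let lift_w h v : linear h -> lift h (w v) = w (lift h v).
Proof.
move=> hl; have wval y : w (val (y : V')) = val y := fixedP y.
have uw x : u (w x) = - w (u x) by rewrite wu opprK.
rewrite /lift Pw uw fixed_projN Pw.
rewrite (linear_funN hl) fixed_valN (operN u).
by rewrite (operD w) (operZ w) wval wu wval.
Qed.

Lemma hyperbolic_lift_comm h :
  linear h -> even_comm A' g' h -> even_comm A g (lift h).
Proof.
move=> hl hg; have ll := hyperbolic_lift_linear hl.
have gik v : g i (g k v) = - u v.
  by rewrite (system_anti sys) // eq_sym.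
have lu v : lift h (u v) = u (lift h v).
  rewrite /lift uK fixed_projZ.
  rewrite (linear_funZ hl) fixed_valZ (operZ u) cK addrC.
  by rewrite (operD u) (operZ u) uK cK addrC addrC.
apply: (even_comm_pivot sys ll kA) => x xA xk v.
have [->|xi] := eqVneq x i; first by rewrite !gik (linear_funN ll) lu.
have [->|xj] := eqVneq x j.
  have gjk y : g j (g k y) = u (w y).
    by rewrite gjE wg // gik opprK.
  by rewrite !gjk lu lift_w.
have xA' : x \in A' by rewrite !inE xi xj.
have ugg y : u (g x (g k y)) = - g x (g k (u y)).
  rewrite /u /= (system_anti sys iA xA) 1?eq_sym //.
  rewrite (system_anti sys iA kA) 1?eq_sym //.
  rewrite (operN (g x)) opprK (system_anti sys kA xA) 1?eq_sym //.
rewrite /lift ugg fixed_projN.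
rewrite (Pg (g k v) xA') (Pg v kA') (Pg (g k (u v)) xA') (Pg (u v) kA').
rewrite (linear_funN hl) fixed_valN (operN u) !hg // !valg //.
by rewrite ugg opprK (operD (g k)) (operD (g x)) (operZ (g k)) (operZ (g x)).
Qed.

Lemma hyperbolic_realizes B :
  realizes (even_comm A' g') B -> realizes (even_comm A g) B.
Proof.
case=> F FR; have Fl := realization_linear FR.
exists (fun b => lift (F b)); split=> [b|b|a b d v|v|b d v|b H|h hl hg].
- exact: hyperbolic_lift_linear.
- by apply: hyperbolic_lift_comm => //; exact: (realization_mem FR).
- rewrite /lift !(realizationP FR) !fixed_valP (operD u) (operZ u) !scalerDr.
  by rewrite addrACA; congr (_ + _ + _); rewrite !scalerA mulrC.
- by rewrite /lift !(realization1 FR) -split_fixed.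
- by rewrite [in RHS]/lift lift_P lift_Pu -!(realizationM FR).
- apply: (realization_inj FR) => y.
  by rewrite -(fixed_valK hyperbolic_invK y) -lift_P H fixed_proj0.
- have hw v : h (w v) = w (h v) by apply: hg.
  have hu v : h (u v) = u (h v) by apply: hg.
  have hval (y : V') : val (P (h (val y))) = h (val y).
    rewrite fixed_projE -hw fixedP -mulr2n -scaler_nat scalerA.
    by rewrite mulVf ?scale1r // pnatr_eq0.
  have [|x y xA yA v|b Fb] := realization_surj FR (h := fun y => P (h (val y))).
  + by move=> a x y; rewrite fixed_valP hl fixed_proj_linear.
  + rewrite !valg // hg ?Pg //; [by case: (A'P xA)|by case: (A'P yA)].
  exists b => v; rewrite /lift -!Fb !hval -hu -(linear_funZ hl).
  by rewrite -(linear_funD hl) -split_fixed.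
Qed.

End HyperbolicStep.

Lemma even_commutant_step (R : realType) (I : finType) p q (B : algType R) :
  (0 < p + q)%N -> even_commutant I p q B -> even_commutant I p.+1 q.+1 B.
Proof.
move=> pq0 H V A s g cp cq sys.
have [i +] : exists i, i \in [set x in A | s x] by apply/card_gt0P; rewrite cp.
rewrite inE => /andP[iA si].
have [j +] : exists j, j \in [set x in A | ~~ s x].
  by apply/card_gt0P; rewrite cq.
rewrite inE => /andP[jA sj].
have cp' : #|[set x in A :\ i :\ j | s x]| = p.
  move: cp; rewrite (cardsD1 i) !inE iA si => -[<-]; apply: eq_card => x.
  rewrite !inE; case: (eqVneq x j) => [->|_].
    by rewrite (negPf sj) !andbF.
  by case: (x == i).
have cq' : #|[set x in A :\ i :\ j | ~~ s x]| = q.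
  move: cq; rewrite (cardsD1 j) !inE jA sj => -[<-]; apply: eq_card => x.
  rewrite !inE; case: (eqVneq x i) => [->|_]; first by rewrite si !andbF.
  by case: (x == j).
have [k kA] : exists k, k \in A :\ i :\ j.
  apply/card_gt0P; move: pq0; rewrite -cp' -cq' addn_gt0.
  case/orP=> /leq_trans; apply; apply/subset_leq_card/subsetP=> x;
    by rewrite inE => /andP[].
have := H _ _ _ _ cp' cq' (hyperbolic_system sys iA jA si (negPf sj)).
exact: (hyperbolic_realizes kA).
Qed.

(** * Reduction of all signatures to the smallest ones *)

Lemma schur_table_mod (R : realType) (m n : int) :
  (m = n %[mod 8])%Z -> schur_table R m = schur_table R n.
Proof. by rewrite /schur_table => ->. Qed.

Lemma even_commutant_table (R : realType) (I : finType) p q :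
  (0 < p + q)%N -> even_commutant I p q (schur_table R (Posz p - Posz q)).
Proof.
have mod8 (m n : int) (h : (m = n %[mod 8])%Z) p' q' :
    even_commutant I p' q' (schur_table R m) ->
    even_commutant I p' q' (schur_table R n).
  by rewrite (schur_table_mod R h).
have step p' q' : (0 < p' + q')%N ->
    even_commutant I p' q' (schur_table R (Posz p' - Posz q')) ->
    even_commutant I p'.+1 q'.+1 (schur_table R (Posz p'.+1 - Posz q'.+1)).
  move=> h0 H; apply: even_commutant_step => //; apply: mod8 H.
  by congr (_ %% _)%Z; rewrite !intS; ring.
have [n] := ubnP (p + q); elim: n p q => // n IHn p q; rewrite ltnS => pqn pq0.
case: p q pqn pq0 => [|p] [|q] // pqn pq0; last first.
- case: p pqn {pq0} => [|p] pqn; last first.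
    apply: step; rewrite ?addSn //; apply: IHn => //; rewrite ?addSn //.
    by rewrite (leq_trans _ pqn) // !addSn !addnS ltnS leqW.
  case: q pqn => [|q] pqn; first exact: even_commutant_1_1.
  apply: step; rewrite ?addnS //; apply: IHn => //.
  by rewrite (leq_trans _ pqn) // !addSn !addnS ltnS.
- case: p pqn {pq0} => [|[|[|[|p]]]] pqn.
  + exact: even_commutant_1_0.
  + exact: even_commutant_2_0.
  + exact: even_commutant_3_0.
  + exact: even_commutant_4_0.
  (* (p + 5, 0) is turned into (p + 1, 4), then into (p, 3). *)
  have -> : p.+4.+1 = (p.+1 + 4)%N by rewrite addn4.
  apply: even_commutant_flipl; rewrite add0n.
  apply: (mod8 (Posz p.+1 - Posz 4)).
    rewrite PoszD (_ : Posz p.+1 + 4 - 0 = 1 * 8 + (Posz p.+1 - 4)) ?modzMDl //.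
    by ring.
  apply: step; rewrite ?addnS //; apply: IHn; rewrite ?addnS //.
  by rewrite (leq_trans _ pqn) // !addnS addn0.
- case: q pqn {pq0} => [|[|[|[|q]]]] pqn.
  + exact: even_commutant_0_1.
  + exact: even_commutant_0_2.
  + exact: even_commutant_0_3.
  + apply: (@even_commutant_flipr _ _ 0 0); exact: even_commutant_4_0.
  (* (0, q + 5) is turned into (4, q + 1), then into (3, q). *)
  have -> : q.+4.+1 = (q.+1 + 4)%N by rewrite addn4.
  apply: even_commutant_flipr; rewrite add0n.
  apply: (mod8 (Posz 4 - Posz q.+1)).
    have -> : Posz 4 - Posz q.+1 = 1 * 8 + (0 - Posz (q.+1 + 4)).
      by rewrite PoszD; ring.
    by rewrite modzMDl.
  apply: step; rewrite ?addnS //; apply: IHn; rewrite ?addnS //.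
  by rewrite (leq_trans _ pqn) // !addnS addn0.
Qed.

(** * Clifford modules as Clifford systems *)

Section RealModule.
Variables (R : realType) (p q : nat).

(** The Clifford module S as a real vector space, through a |-> a%:A. *)
Definition real_module (S : lmodType (clifford R p q)) : Type := S.

Section Structure.
Variable S : lmodType (clifford R p q).

HB.instance Definition _ := GRing.Zmodule.on (real_module S).

Definition real_scale (a : R) (v : real_module S) : real_module S :=
  (a%:A : clifford R p q) *: (v : S).

Lemma real_scaleA a b v : real_scale a (real_scale b v) = real_scale (a * b) v.
Proof. by rewrite /real_scale scalerA -scalerAl mul1r scalerA. Qed.
Lemma real_scale1 : left_id 1 real_scale.
Proof. by move=> v; rewrite /real_scale !scale1r. Qed.
Lemma real_scaleDr : right_distributive real_scale +%R.
Proof. by move=> a u v; exact: scalerDr. Qed.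
Lemma real_scaleDl v : {morph real_scale^~ v : a b / a + b}.
Proof. by move=> a b; rewrite /real_scale !scalerDl. Qed.

HB.instance Definition _ := GRing.Zmodule_isLmodule.Build R (real_module S)
  real_scaleA real_scale1 real_scaleDr real_scaleDl.

Definition clifford_act (x : clifford R p q) (v : real_module S) :
  real_module S := x *: (v : S).

Lemma clifford_act_linear x : linear (clifford_act x).
Proof.
move=> a u v; rewrite /clifford_act scalerDr.
by congr (_ + _); rewrite [LHS]scalerA [RHS]scalerA scalar_comm.
Qed.

HB.instance Definition _ x :=
  GRing.isLinear.Build R (real_module S) (real_module S) _
    (clifford_act x) (clifford_act_linear x).

Lemma clifford_actM x y v :
  clifford_act (x * y) v = clifford_act x (clifford_act y v).
Proof. by rewrite /clifford_act scalerA. Qed.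
Lemma clifford_actZ a x v : clifford_act (a *: x) v = a *: clifford_act x v.
Proof. by rewrite -[a *: x]mulr_algl clifford_actM. Qed.
Lemma clifford_actD x y v :
  clifford_act (x + y) v = clifford_act x v + clifford_act y v.
Proof. exact: (scalerDl (v : S) x y). Qed.
Lemma clifford_act0 v : clifford_act 0 v = 0.
Proof. exact: (scale0r (v : S)). Qed.
Lemma clifford_act1 v : clifford_act 1 v = v.
Proof. exact: (scale1r (v : S)). Qed.
Lemma clifford_act_basis x v : clifford_act x v =
  \sum_(A : {set 'I_(p + q)})
     clifford_coef x A *: clifford_act (clifford_basis R A) v.
Proof.
rewrite {1}(clifford_sum_basis x).
rewrite (big_morph (clifford_act^~ v) (fun x y => clifford_actD x y v)
  (clifford_act0 v)).
by apply: eq_bigr => A _; rewrite clifford_actZ.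
Qed.

Definition clifford_gen (i : 'I_(p + q)) :
  {linear real_module S -> real_module S} :=
  clifford_act (clifford_basis R [set i]).

Lemma clifford_genE i v :
  clifford_gen i v = clifford_act (clifford_basis R [set i]) v.
Proof. by []. Qed.

End Structure.

Local Notation I := 'I_(p + q).
Local Notation eb := (@clifford_basis R p q).

Lemma basis_sign1 (i j : I) : basis_sign R [set i] [set j] = gen_sign R i j.
Proof. by rewrite /basis_sign !big_set1. Qed.

Lemma clifford_basis_split (A : {set I}) i : i \in A ->
  exists c : R, eb A = c *: (eb [set i] * eb (A :\ i)).
Proof.
move=> iA; exists (basis_sign R [set i] (A :\ i)).
rewrite clifford_basisM scalerA /basis_sign big_set1 -big_split big1 => [|j _].
  rewrite scale1r; congr clifford_basis; apply/setP => j; rewrite !inE.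
  by case: (eqVneq j i) => [->|_]; rewrite ?iA.
exact: gen_sign_sqr.
Qed.

Lemma even_basis_pair (i j : I) : clifford_even (eb [set i] * eb [set j]).
Proof.
move=> A oA; rewrite clifford_basisM clifford_coefZ clifford_coef_basis.
case: eqP => [AE|_]; last by rewrite mulr0.
move: oA; rewrite {}AE; have [->|ij] := eqVneq i j.
  by rewrite symdiffv cards0.
rewrite (_ : symdiff _ _ = [set i; j]) ?cards2 ?ij //.
by apply/setP => k; rewrite !inE; have [->|] := eqVneq k i.
Qed.

Lemma even_basis_ind (P : {set I} -> Prop) : P set0 ->
  (forall (A : {set I}) i j,
    i \in A -> j \in A :\ i -> P (A :\ i :\ j) -> P A) ->
  forall A : {set I}, ~~ odd #|A| -> P A.
Proof.
move=> P0 PS A; have [n] := ubnP #|A|; elim: n A => // n IHn A.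
rewrite ltnS => An eA.
have [->//|[i iA]] := set_0Vmem A.
move: An eA; rewrite (cardsD1 i) iA /= negbK => An oA.
have [A0|[j jA]] := set_0Vmem (A :\ i); first by rewrite A0 cards0 in oA.
move: An oA; rewrite (cardsD1 j) jA => An oA.
apply: (PS _ i j) => //; apply: IHn => //.
by rewrite (leq_trans _ An) // ltnS leqW.
Qed.

Section Irreducible.
Variable S : irrModule (clifford R p q).
Local Notation V := (real_module S).
Local Notation g := (clifford_gen S).

Lemma clifford_module_system :
  clifford_system [set: I] (fun i : I => (i < p)%N) g.
Proof.
split=> [i _ v|i j _ _ ij v||W WP Wg].
- rewrite !clifford_genE -clifford_actM clifford_basisM basis_sign1 symdiffv.
  rewrite clifford_basis0 clifford_actZ clifford_act1 /gen_sign ltnn eqxx.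
  by case: ifP.
- rewrite !clifford_genE -!clifford_actM !clifford_basisM !basis_sign1 symdiffC.
  rewrite !clifford_actZ -scaleNr; congr (_ *: _).
  rewrite /gen_sign [j == i]eq_sym (negPf ij).
  by case: ltngtP => [_|_|/val_inj /eqP]; rewrite ?opprK // (negPf ij).
- by case: (irr_moduleP S).
- have Wb A v : W v -> W (clifford_act (eb A) v).
    have [n] := ubnP #|A|; elim: n A v => // n IHn A v; rewrite ltnS => An Wv.
    have [->|[i iA]] := set_0Vmem A.
      by rewrite clifford_basis0 clifford_act1.
    have [c ->] := clifford_basis_split iA.
    rewrite clifford_actZ clifford_actM; apply: (subspaceZ WP).
    by apply: Wg => //; apply: IHn => //; rewrite (cardsD1 i) iA in An.
  have Wx x v : W v -> W (clifford_act x v).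
    move=> Wv; rewrite clifford_act_basis; apply: big_ind => [|u u'|A _].
    + by case: WP.
    + exact: (subspaceD WP).
    + by apply: (subspaceZ WP); apply: Wb.
  have [|H|H] := (irr_moduleP S).2 (fun v => `[< W v >]).
  + split=> [|a u v /asboolP Wu /asboolP Wv]; apply/asboolP; first by case: WP.
    by apply: (subspaceD WP) => //; apply: Wx.
  + by left=> v Wv; apply: H; apply/asboolP.
  + by right=> v; apply/asboolP; apply: H.
Qed.

(** Up to sign, a basis element of the even part is a product of pairs of
    generators. *)
Lemma so_invariantP (h : V -> V) : linear h ->
  so_invariant (h : S -> S) <-> even_comm [set: I] g h.
Proof.
move=> hl; split=> [H i j _ _ v|H x xE v].
  rewrite !clifford_genE -!clifford_actM; exact: (H _ (even_basis_pair i j)).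
have Hb : forall A : {set I}, ~~ odd #|A| ->
    forall v, h (clifford_act (eb A) v) = clifford_act (eb A) (h v).
  apply: even_basis_ind => [u|A i j iA jA IH u].
    by rewrite clifford_basis0 !clifford_act1.
  have [c ->] := clifford_basis_split iA.
  have [d ->] := clifford_basis_split jA.
  rewrite -scalerAr scalerA mulrA !clifford_actZ (linear_funZ hl).
  by rewrite !clifford_actM -!clifford_genE -IH (H i j (in_setT _) (in_setT _)).
have -> : h (x *: (v : S)) = h (clifford_act x v) by [].
have -> : x *: (h v : S) = clifford_act x (h v) by [].
rewrite !(clifford_act_basis x) (big_morph h (linear_funD hl) (linear_fun0 hl)).
apply: eq_bigr => A _; rewrite (linear_funZ hl).
have [oA|eA] := boolP (odd #|A|).
  by rewrite xE // !scale0r.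
by rewrite Hb.
Qed.

Lemma schur_realizes (B : algType R) :
  realizes (even_comm [set: I] g) B -> alg_iso (schur S) B.
Proof.
case=> F FR; apply: alg_iso_sym.
have FS b : (F b : S -> S) \in @schur_pred R p q S.
  apply: schur_predP; first exact: linear_funD (realization_linear FR b).
  apply/so_invariantP; first exact: realization_linear FR b.
  exact: realization_mem FR b.
pose f b : schur S := Defs.Schur (FS b).
have fl : linear f.
  by move=> a b c; apply: schur_eqP => v; exact: realizationP FR a b c v.
have fm : monoid_morphism f.
  split=> [|b c]; apply: schur_eqP => v; first exact: realization1 FR v.
  exact: realizationM FR b c v.
apply: (alg_isoP fl fm).
have fi b c : f b = f c -> b = c.
  move=> bc; apply/eqP; rewrite -subr_eq0; apply/eqP/(realization_inj FR) => v.
  rewrite addrC -scaleN1r (realizationP FR) scaleN1r.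
  by rewrite -[F b v]/(f b v) bc addNr.
have fs (h : schur S) : exists b, f b = h.
  have hl : linear (h : V -> V) by move=> a u v; exact: (schur_linear h a u v).
  have hinv := (so_invariantP hl).1 (@schur_invariant _ _ _ _ h).
  have [b hb] := realization_surj FR hl hinv.
  by exists b; apply: schur_eqP => v; rewrite hb.
pose k h := projT1 (cid (fs h)).
have fK h : f (k h) = h by rewrite /k; case: cid.
by exists k => // b; apply: fi; rewrite fK.
Qed.

End Irreducible.

Lemma card_signature :
  #|[set i in [set: I] | (i < p)%N]| = p /\
  #|[set i in [set: I] | ~~ (i < p)%N]| = q.
Proof.
have -> : [set i in [set: I] | (i < p)%N] = @lshift p q @: [set: 'I_p].
  apply/setP => i; rewrite !inE; apply/idP/imsetP => [ip|[j _ ->]].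
    by exists (Ordinal ip) => //; apply: val_inj.
  by rewrite /= ltn_ord.
have -> : [set i in [set: I] | ~~ (i < p)%N] = @rshift p q @: [set: 'I_q].
  apply/setP => i; rewrite !inE -leqNgt; apply/idP/imsetP => [ip|[j _ ->]].
    have iq : (i - p < q)%N by rewrite ltn_subLR.
    by exists (Ordinal iq) => //; apply: val_inj; rewrite /= subnKC.
  by rewrite /= leq_addr.
rewrite !card_imset ?cardsT ?card_ord //; first exact: rshift_inj.
exact: lshift_inj.
Qed.

End RealModule.

Lemma schur_classification (R : realType) (p q : nat)
    (S : irrModule (clifford R p q)) :
  (0 < p + q)%N -> alg_iso (schur S) (schur_table R (Posz p - Posz q)%R).
Proof.
move=> pq0; apply: schur_realizes.
have [cp cq] := card_signature p q.
have sys := clifford_module_system S.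
exact: (@even_commutant_table R _ p q pq0 _ _ _ _ cp cq sys).
Qed.

Theorem corollary1p10 (R : realType) :
  (forall (p q : nat) (S : irrModule (clifford R p q)),
      (0 < p + q)%N ->
      alg_iso (schur S) (schur_table R (Posz p - Posz q)%R))
  /\
  (forall (p q p' q' : nat)
      (S : irrModule (clifford R p q)) (S' : irrModule (clifford R p' q')),
      (0 < p + q)%N -> (0 < p' + q')%N ->
      (Posz p - Posz q = Posz p' - Posz q' %[mod 8])%Z ->
      alg_iso (schur S) (schur S'))
  /\
  (forall (p q k : nat)
      (S : irrModule (clifford R p q))
      (S' : irrModule (clifford R (8 * k - q) (8 * k - p))),
      (0 < p + q)%N -> (p <= 8 * k)%N -> (q <= 8 * k)%N ->
      (0 < (8 * k - q) + (8 * k - p))%N ->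
      alg_iso (schur S) (schur S')).
Proof.
have cong (p q p' q' : nat)
      (S : irrModule (clifford R p q)) (S' : irrModule (clifford R p' q')) :
      (0 < p + q)%N -> (0 < p' + q')%N ->
      (Posz p - Posz q = Posz p' - Posz q' %[mod 8])%Z ->
      alg_iso (schur S) (schur S').
  move=> pq0 pq0' E; apply: alg_iso_trans (schur_classification S pq0) _.
  rewrite (schur_table_mod R E); apply: alg_iso_sym.
  exact: schur_classification.
split; first by move=> p q S; exact: schur_classification.
split=> // p q k S S' pq0 pk qk pq0'; apply: cong => //.
by congr (_ %% _)%Z; rewrite -!subzn //; ring.
Qed.
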